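(* Let $\zeta_3=e^{2\pi i/3}$ and $Y(t)=1-\left(\frac{1-t}{1+2t}\right)^3$. Then for all $u\in\mathbb{C}$ with $0<|u|$ sufficiently small, \[n(u^3)=\sum_{j=0}^{2} n\!\left(Y(\zeta_3^j u)\right).\]
   Context: $n(t)=\mathrm{m}\!\left(x^3+y^3+1-\frac{3}{t^{1/3}}xy\right)$, where $\mathrm{m}$ is the logarithmic Mahler measure $\mathrm{m}(P)=\int_0^1\int_0^1\log|P(e^{2\pi i\theta_1},e^{2\pi i\theta_2})|d\theta_1d\theta_2$ (independent of the choice of cube root). *)

(* Defs.v *)
From HB Require Import structures.
From mathcomp Require Import all_boot all_order all_algebra.
From mathcomp Require Import all_classical all_reals all_analysis.
From mathcomp Require Import complex.
Set Implicit Arguments. Unset Strict Implicit. Unset Printing Implicit Defensive.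
Import Order.TTheory GRing.Theory Num.Theory.
Local Open Scope classical_set_scope.
Local Open Scope ring_scope.

Definition expi (R : realType) (theta : R) : R[i] :=
  Complex (cos (2 * pi * theta)) (sin (2 * pi * theta)).

Definition mahler2 (R : realType) (P : R[i] -> R[i] -> R[i]) : R :=
  Rintegral ((@lebesgue_measure R) \x (@lebesgue_measure R))%E
    (`[0, 1] `*` `[0, 1])
    (fun p => ln (ComplexField.Normc.normc (P (expi p.1) (expi p.2)))).

Definition Nk (R : realType) (k : R[i]) : R :=
  mahler2 (fun x y => x ^+ 3 + y ^+ 3 + 1 - k * x * y).

Definition cbrt (R : realType) (t : R[i]) : R[i] := xget 0 [set s : R[i] | s ^+ 3 = t].

Definition nfun (R : realType) (t : R[i]) : R := Nk (3 / cbrt t).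

Definition zeta3 (R : realType) : R[i] := expi (1 / 3 : R).

Definition Yfun (R : realType) (t : R[i]) : R[i] := 1 - ((1 - t) / (1 + 2 * t)) ^+ 3.

(* Main.v *)
Require Import Defs.
From HB Require Import structures.
From mathcomp Require Import all_boot all_order all_algebra.
From mathcomp Require Import all_classical all_reals all_analysis.
From mathcomp Require Import measurable_realfun complex.
From mathcomp Require Import ring lra zify.
Import Order.TTheory GRing.Theory Num.Theory.
Import numFieldNormedType.Exports.
Set Implicit Arguments. Unset Strict Implicit. Unset Printing Implicit Defensive.
Local Open Scope ring_scope.
Local Notation Re := complex.Re.
Local Notation Im := complex.Im.

(** Put S(t) = sum_(m >= 1) b_m t^m / m and F(t) = sum_(m >= 0) b_m t^m with
    b_m = (3m)! / (m!^3 27^m).  On the torus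
    x^3 + y^3 + 1 - k x y = - k x y (1 - w / k) with |w| <= 3, so expanding the
    logarithm and integrating the powers of w gives, for small t,
      3 n(t) = 3 log 3 - log |t| - Re S(t).
    The cubic transformation F(Y(t)) = (1 + 2 t) F(t^3) holds because both sides
    are power series solutions, with the same constant term, of one Fuchsian
    equation (p G')' = q G.  It yields
      t d/dt (S(Y(t)) + log (Y(t) / t)) + 1 = (1 - t)^3 F(t^3) / (1 - t^3),
    and since F(t^3) / (1 - t^3) is a series in t^3 and (1 - t)^3 has constant
    term 1 and t^3-coefficient -1, the part of the left side in exponents
    divisible by 3 is F(t^3); this part is what the sum over the cube roots of
    unity picks out.  Convergence is handled by comparing truncations with an
    error O(2^-M) for every M. *)

(** * Formal power series *)

(** The record keeps the ring product free to be the Cauchy product, apart from the pointwise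
    product of functions. *)
Record fps (K : Type) := Fps { fcoef :> nat -> K }.

Lemma fpsP (K : Type) (f g : fps K) : (forall n, f n = g n) -> f = g.
Proof.
case: f g => [f] [g] /= fg; congr Fps.
exact: (@boolp.functional_extensionality_dep nat (fun=> K)).
Qed.

HB.instance Definition _ (K : Type) := gen_eqMixin (fps K).
HB.instance Definition _ (K : Type) := gen_choiceMixin (fps K).

Section FpsRing.
Variable K : comNzRingType.
Implicit Types f g h : fps K.

Definition fadd f g := Fps (fun n => f n + g n).
Definition fopp f := Fps (fun n => - f n).
Definition fmul f g := Fps (fun n => \sum_(i < n.+1) f i * g (n - i)%N).
Definition fconst (c : K) := Fps (fun n => c *+ (n == 0)%N).

Lemma faddA : associative fadd.
Proof. by move=> f g h; apply: fpsP => n /=; rewrite addrA. Qed.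
Lemma faddC : commutative fadd.
Proof. by move=> f g; apply: fpsP => n /=; rewrite addrC. Qed.
Lemma fadd0 : left_id (fconst 0) fadd.
Proof. by move=> f; apply: fpsP => n /=; rewrite mul0rn add0r. Qed.
Lemma faddN : left_inverse (fconst 0) fopp fadd.
Proof. by move=> f; apply: fpsP => n /=; rewrite mul0rn addNr. Qed.

HB.instance Definition _ :=
  GRing.isZmodule.Build (fps K) faddA faddC fadd0 faddN.

Definition ftrunc N f : {poly K} := \poly_(i < N) f i.

(** Coefficients of a product depend only on polynomial truncations, so associativity, commutativity
    and the Leibniz rule are inherited from [{poly K}]. *)
Lemma fmulE N f g n : (n < N)%N -> fmul f g n = (ftrunc N f * ftrunc N g)`_n.
Proof.
move=> nN; rewrite coefM; apply: eq_bigr => i _.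
rewrite !coef_poly (leq_ltn_trans (leq_subr _ _) nN).
by rewrite (leq_ltn_trans _ nN) // -ltnS.
Qed.

Lemma fmulA : associative fmul.
Proof.
move=> f g h; apply: fpsP => n.
transitivity (ftrunc n.+1 f * ftrunc n.+1 g * ftrunc n.+1 h)`_n.
  rewrite -mulrA coefM; apply: eq_bigr => i _.
  rewrite -fmulE ?ltnS ?leq_subr //.
  by rewrite coef_poly ltn_ord.
rewrite coefM; apply: eq_bigr => i _.
by rewrite -fmulE // coef_poly ltnS leq_subr.
Qed.

Lemma fmulC : commutative fmul.
Proof. by move=> f g; apply: fpsP => n; rewrite !(@fmulE n.+1) // mulrC. Qed.

Lemma fmul1 : left_id (fconst 1) fmul.
Proof.
move=> f; apply: fpsP => n /=.
rewrite big_ord_recl /= subn0 mul1r big1 ?addr0 // => i _.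
by rewrite mul0r.
Qed.

Lemma fmulDl : left_distributive fmul fadd.
Proof.
move=> f g h; apply: fpsP => n /=; rewrite -big_split.
by apply: eq_bigr => i _; rewrite mulrDl.
Qed.

Lemma fone_neq0 : fconst 1 != 0 :> fps K.
Proof.
apply/eqP => /(congr1 (fun f : fps K => f 0%N)) /= /eqP.
by rewrite oner_eq0.
Qed.

HB.instance Definition _ :=
  GRing.Zmodule_isComNzRing.Build (fps K) fmulA fmulC fmul1 fmulDl fone_neq0.

Lemma fcoefD f g n : (f + g) n = f n + g n. Proof. by []. Qed.
Lemma fcoefN f n : (- f) n = - f n. Proof. by []. Qed.
Lemma fcoefB f g n : (f - g) n = f n - g n. Proof. by []. Qed.
Lemma fcoefM f g n : (f * g) n = \sum_(i < n.+1) f i * g (n - i)%N.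
Proof. by []. Qed.
Lemma fcoef0 n : (0 : fps K) n = 0.
Proof. by rewrite /= mul0rn. Qed.
Lemma fcoef1 n : (1 : fps K) n = (n == 0)%N%:R. Proof. by []. Qed.
Lemma fcoefMn f k n : (f *+ k) n = f n *+ k.
Proof. by elim: k => [|k IH]; rewrite ?mulr0n ?fcoef0 // !mulrS fcoefD IH. Qed.
Definition fX : fps K := Fps (fun n => (n == 1)%N%:R).

Lemma fcoefXM0 f : (fX * f) 0%N = 0.
Proof. by rewrite fcoefM big_ord1 mul0r. Qed.

Lemma fcoefXMS f n : (fX * f) n.+1 = f n.
Proof.
rewrite fcoefM big_ord_recl mul0r add0r big_ord_recl /= mul1r subSS subn0.
by rewrite big1 ?addr0 // => i _; rewrite mul0r.
Qed.

Definition fderiv f := Fps (fun n => f n.+1 *+ n.+1).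

Lemma fderivD f g : fderiv (f + g) = fderiv f + fderiv g.
Proof. by apply: fpsP => n /=; rewrite mulrnDl. Qed.

Lemma fderivN f : fderiv (- f) = - fderiv f.
Proof. by apply: fpsP => n /=; rewrite mulNrn. Qed.

Lemma fderiv1 : fderiv 1 = 0.
Proof. by apply: fpsP => n; rewrite fcoef0 /= mul0rn. Qed.

Lemma fderivX : fderiv fX = 1.
Proof. by apply: fpsP => -[|n] /=; rewrite ?mulr1n // mul0rn. Qed.

Lemma fcoefXderiv f n : (fX * fderiv f) n = f n *+ n.
Proof. by case: n => [|n]; rewrite ?fcoefXM0 ?mulr0n // fcoefXMS. Qed.

Lemma ftrunc_deriv N f : (ftrunc N.+1 f)^`() = ftrunc N (fderiv f).
Proof.
apply/polyP => i; rewrite coef_deriv !coef_poly ltnS.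
by case: ifP => // _; rewrite mul0rn.
Qed.

Lemma fderivM f g : fderiv (f * g) = fderiv f * g + f * fderiv g.
Proof.
apply: fpsP => n; rewrite fcoefD.
have -> : (fderiv (f * g)) n = (ftrunc n.+2 f * ftrunc n.+2 g)^`()`_n.
  by rewrite coef_deriv -fmulE.
rewrite derivM coefD !ftrunc_deriv; congr (_ + _).
  rewrite coefM; apply: eq_bigr => i _.
  by rewrite !coef_poly ltn_ord (leq_ltn_trans (leq_subr i n)).
rewrite coefM; apply: eq_bigr => i _.
by rewrite !coef_poly (leq_trans (ltn_ord i)) // ltnS leq_subr.
Qed.

Lemma fderivXn f n : fderiv (f ^+ n.+1) = (f ^+ n * fderiv f) *+ n.+1.
Proof.
elim: n => [|n IH]; first by rewrite expr1 expr0 mul1r.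
by rewrite exprS fderivM IH [in RHS]mulrS exprS mulrnAr; congr (_ + _); ring.
Qed.

Lemma fexp_coef_lt f k n : f 0%N = 0 -> (n < k)%N -> (f ^+ k) n = 0.
Proof.
move=> f0; elim: k n => // k IH n nk; rewrite exprS fcoefM.
rewrite big1 // => -[[|i] /= ik] _; first by rewrite f0 mul0r.
rewrite IH ?mulr0 //; move: ik nk; rewrite !ltnS; case: n => // n _.
by rewrite subSS => nk; apply: leq_ltn_trans (leq_subr _ _) nk.
Qed.

(** Cutting the sum at k = n gives true substitution when g has constant term 0, since g^k then has
    no term below degree k. *)
Definition fcomp f g := Fps (fun n => \sum_(k < n.+1) f k * (g ^+ k) n).

(** Padding with vanishing terms gives all coefficients below N one range of summation, so that sums
    can be exchanged. *)
Lemma fcompE N f g n : g 0%N = 0 -> (n < N)%N ->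
  fcomp f g n = \sum_(k < N) f k * (g ^+ k) n.
Proof.
move=> g0 nN; rewrite /=.
rewrite -!(big_mkord xpredT (fun k => f k * (g ^+ k) n)).
rewrite [RHS](@big_cat_nat _ _ _ n.+1) //= [X in _ + X]big_nat_cond.
rewrite [X in _ + X]big1 ?addr0 //= => i /andP[/andP[ni _] _].
by rewrite fexp_coef_lt ?mulr0.
Qed.

Lemma fcompD f1 f2 g : fcomp (f1 + f2) g = fcomp f1 g + fcomp f2 g.
Proof.
apply: fpsP => n; rewrite /= -big_split.
by apply: eq_bigr => i _; rewrite mulrDl.
Qed.

Lemma fcompN f g : fcomp (- f) g = - fcomp f g.
Proof.
apply: fpsP => n; rewrite /= -sumrN.
by apply: eq_bigr => i _; rewrite mulNr.
Qed.

Lemma fcompMn f g n : fcomp (f *+ n) g = fcomp f g *+ n.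
Proof.
apply: fpsP => m; rewrite fcoefMn /= -sumrMnl.
by apply: eq_bigr => i _; rewrite fcoefMn mulrnAl.
Qed.

Lemma fcomp1 g : fcomp 1 g = 1.
Proof.
apply: fpsP => n /=; rewrite big_ord_recl /= mul1r big1 ?addr0 // => i _.
by rewrite mul0r.
Qed.

Lemma fcompXM f g : g 0%N = 0 -> fcomp (fX * f) g = g * fcomp f g.
Proof.
move=> g0; apply: fpsP => n.
rewrite (@fcompE n.+2) // big_ord_recl fcoefXM0 mul0r add0r.
rewrite [RHS]fcoefM [RHS](eq_bigr (fun i : 'I_n.+1 =>
    \sum_(k < n.+1) g i * (f k * (g ^+ k) (n - i)%N))); last first.
  by move=> i _; rewrite (@fcompE n.+1) ?ltnS ?leq_subr // mulr_sumr.
rewrite exchange_big; apply: eq_bigr => k _.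
rewrite lift0 fcoefXMS exprS fcoefM mulr_sumr.
by apply: eq_bigr => i _; ring.
Qed.

Lemma fderiv_comp f g : g 0%N = 0 ->
  fderiv (fcomp f g) = fcomp (fderiv f) g * fderiv g.
Proof.
move=> g0; apply: fpsP => n.
transitivity (\sum_(k < n.+1) f k.+1 *+ k.+1 * (g ^+ k * fderiv g) n).
  rewrite [LHS]/= big_ord_recl /= mulr0 add0r -sumrMnl.
  apply: eq_bigr => k _.
  have := congr1 (fun h : fps K => h n) (fderivXn g k).
  rewrite fcoefMn [LHS]/= => E.
  by rewrite -mulrnAr /bump /= add1n E mulrnAl mulrnAr.
rewrite [RHS]fcoefM.
rewrite [RHS](eq_bigr (fun i : 'I_n.+1 => \sum_(k < n.+1)
    f k.+1 *+ k.+1 * ((g ^+ k) i * fderiv g (n - i)%N))); last first.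
  move=> i _; rewrite (@fcompE n.+1) // mulr_suml.
  by apply: eq_bigr => k _; rewrite mulrA.
rewrite exchange_big; apply: eq_bigr => k _.
by rewrite fcoefM mulr_sumr.
Qed.

End FpsRing.

Arguments fX {K}.

(* The coefficient of X^n on the left is (n+1)^2 g_{n+1} plus lower terms. *)
Lemma fuchs_unique (K : numFieldType) (w q g : fps K) :
  w 0%N = 1 -> g 0%N = 0 -> fderiv (fX * w * fderiv g) = q * g -> g = 0.
Proof.
move=> w0 g0 E; apply: fpsP => n; rewrite fcoef0.
elim/ltn_ind: n => -[//|n] IH.
have := congr1 (fun h : fps K => h n) E.
rewrite -mulrA.
have -> : fderiv (fX * (w * fderiv g)) n = (fX * (w * fderiv g)) n.+1 *+ n.+1.
  by [].
rewrite fcoefXMS !fcoefM.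
rewrite [X in _ = X -> _]big1; last first.
  by move=> i _; rewrite IH ?mulr0 // ltnS leq_subr.
rewrite big_ord_recl w0 mul1r subn0 big1 ?addr0; last first.
  move=> i _; rewrite lift0 /= IH ?mul0rn ?mulr0 //.
  by rewrite ltnS ltn_subrL /= (leq_ltn_trans _ (ltn_ord i)).
move/eqP; rewrite /= -mulrnA mulrn_eq0 => /orP[|/eqP //].
by rewrite muln_eq0.
Qed.

(** * The cubic transformation of 2F1(1/3,2/3;1) *)

Section Cubic.
Variable K : numFieldType.
Local Notation X := (@fX K).
Local Notation D := (@fderiv K).
Implicit Types f g : fps K.

(** This is (3m)! / m!^3, in the shape produced by two nested binomial expansions. *)
Definition trinom m : nat := ('C(3 * m, 2 * m) * 'C(2 * m, m))%N.

Lemma trinom_fact m : (trinom m * m`! ^ 3 = (3 * m)`!)%N.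
Proof.
have E1' : ('C(3 * m, 2 * m) * ((2 * m)`! * m`!) = (3 * m)`!)%N.
  by rewrite -[in RHS](@bin_fact (3 * m) (2 * m)) ?leq_mul2r ?orbT // -mulnBl mul1n.
have E2' : ('C(2 * m, m) * (m`! * m`!) = (2 * m)`!)%N.
  by rewrite -[in RHS](@bin_fact (2 * m) m) ?leq_pmull // mul2n -addnn addnK.
by rewrite -E1' -E2' /trinom !expnS expn0 muln1; lia.
Qed.

(** After multiplication by (m+1) m!^3, [trinom_fact] reduces both sides to factorials. *)
Lemma trinomS m :
  (trinom m.+1 * m.+1 ^ 2 = 3 * (3 * m + 1) * (3 * m + 2) * trinom m)%N.
Proof.
have H : (0 < m.+1 * m`! ^ 3)%N by rewrite muln_gt0 expn_gt0 fact_gt0.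
apply/eqP; rewrite -(eqn_pmul2r H); apply/eqP.
have := trinom_fact m.+1; have := trinom_fact m.
have -> : (3 * m.+1 = (3 * m).+3)%N by lia.
rewrite !factS => E0 E1.
transitivity (trinom m.+1 * (m.+1 * m`!) ^ 3)%N.
  by rewrite !expnS !expn0; lia.
by rewrite E1 -E0 !expnS !expn0; nia.
Qed.

(** The number b_m, equal to (1/3)_m (2/3)_m / m!^2, so the series is 2F1(1/3,2/3;1;t). *)
Definition hyp m : K := (trinom m)%:R / 27 ^+ m.

Lemma hypS m : 9 * (m.+1)%:R ^+ 2 * hyp m.+1
  = (3 * m%:R + 1) * (3 * m%:R + 2) * hyp m.
Proof.
have := trinomS m; rewrite /hyp [27 ^+ m.+1]exprS invfM.
move: (trinom m.+1) (trinom m) => t' t E0.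
have := erefl ((t' * m.+1 ^ 2)%:R : K); rewrite [in RHS]E0.
rewrite natrM natrX natrM natrM natrM natrD natrD natrM => E.
have -> : 9 * (m.+1)%:R ^+ 2 * (t'%:R * (27^-1 / 27 ^+ m))
  = (t'%:R * (m.+1)%:R ^+ 2) * (9 / 27) / 27 ^+ m :> K by ring.
rewrite E.
have -> : 9 / 27 = 3^-1 :> K by field.
by field; rewrite expf_neq0 // pnatr_eq0.
Qed.

Lemma hyp0 : hyp 0 = 1.
Proof. by rewrite /hyp expr0 divr1. Qed.

Definition fhyp := Fps hyp.
(* The division by zero at m = 0 gives the coefficient 0. *)
Definition fhypS := Fps (fun m => hyp m / m%:R).
(* The inverse of 1 + 2X. *)
Definition fgeo := Fps (fun n => (-2) ^+ n : K).

Lemma fgeoP : (1 + 2 * X) * fgeo = 1.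
Proof.
have -> : (1 + 2 * X) * fgeo = fgeo + (X * fgeo) *+ 2 by ring.
apply: fpsP => -[|n]; rewrite fcoefD fcoefMn ?fcoefXM0 ?fcoefXMS fcoef1 /=.
  by rewrite expr0 mul0rn addr0.
by rewrite exprS; ring.
Qed.

Lemma fderiv_hypS : X * D fhypS = fhyp - 1.
Proof.
apply: fpsP => -[|n]; rewrite fcoefXderiv fcoefB fcoef1 /=.
  by rewrite mulr0n hyp0 subrr.
by rewrite subr0 -[LHS]mulr_natr divfK ?pnatr_eq0.
Qed.

Lemma fmulIn n f g : f *+ n.+1 = g *+ n.+1 -> f = g :> fps K.
Proof.
move=> E; apply: fpsP => m.
have := congr1 (fun h : fps K => h m) E; rewrite !fcoefMn.
by move/eqP; rewrite eqrMn2r //= => /eqP.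
Qed.

(** The hypergeometric equation in divergence form; its coefficient at X^n is the recurrence
    [hypS]. *)
Lemma fhyp_ode : D (X * (1 - X) * D fhyp) *+ 9 = fhyp *+ 2.
Proof.
apply: fpsP => n; rewrite !fcoefMn.
have -> : X * (1 - X) * D fhyp = X * D fhyp - X * (X * D fhyp) by ring.
have -> f : D f n = f n.+1 *+ n.+1 by [].
rewrite fcoefB fcoefXderiv fcoefXMS fcoefXderiv /=.
have E := hypS n.
have -> : (hyp n.+1 *+ n.+1 - hyp n *+ n) *+ n.+1 *+ 9 =
  9 * n.+1%:R ^+ 2 * hyp n.+1 - 9 * n.+1%:R * n%:R * hyp n.
  by ring.
by rewrite E -natr1; ring.
Qed.

(** Pullback by the chain rule; [fcomp (D fhyp) g] stands for D(F o g) / D g, which avoids a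
    division. *)
Lemma fhyp_comp_ode g : g 0%N = 0 ->
  D (g * (1 - g) * fcomp (D fhyp) g) *+ 9 = fcomp fhyp g * D g *+ 2.
Proof.
move=> g0.
have -> : g * (1 - g) * fcomp (D fhyp) g = fcomp (X * (1 - X) * D fhyp) g.
  have -> : X * (1 - X) * D fhyp = X * D fhyp - X * (X * D fhyp) by ring.
  by rewrite fcompD fcompN !fcompXM //; ring.
by rewrite fderiv_comp // -[LHS]mulrnAl -[_ *+ 9]fcompMn fhyp_ode fcompMn mulrnAl.
Qed.

(* The expansion of [Yfun]: 1 - ((1-X)/(1+2X))^3 = 9X(1+X+X^2)/(1+2X)^3. *)
Definition fY := 9 * X * (1 + X + X ^+ 2) * fgeo ^+ 3.

Lemma fY0 : fY 0%N = 0.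
Proof.
have -> : fY = X * (9 * (1 + X + X ^+ 2) * fgeo ^+ 3) by rewrite /fY; ring.
exact: fcoefXM0.
Qed.

Lemma fX3_0 : (X ^+ 3) 0%N = 0.
Proof. by rewrite exprS fcoefXM0. Qed.

Lemma fderiv_nat n : D n%:R = 0.
Proof.
apply: fpsP => m; rewrite fcoef0.
transitivity ((n%:R : fps K) m.+1 *+ m.+1) => //.
by rewrite fcoefMn fcoef1 !mul0rn.
Qed.

Lemma fderivX2 : D (X ^+ 2) = 2 * X.
Proof. by rewrite fderivXn fderivX; ring. Qed.
Lemma fderivX3 : D (X ^+ 3) = 3 * X ^+ 2.
Proof. by rewrite fderivXn fderivX; ring. Qed.

Lemma fderiv_geo : D fgeo = - 2 * fgeo ^+ 2.
Proof.
have := congr1 D fgeoP; have m := fgeoP.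
rewrite fderiv1 fderivM fderivD fderiv1 fderivM fderivX fderiv_nat => E.
transitivity (D fgeo * ((1 + 2 * X) * fgeo)); first by rewrite m mulr1.
move: E; set d := D fgeo => E.
transitivity (((0 + (0 * X + 2 * 1)) * fgeo + (1 + 2 * X) * d) * fgeo
   - 2 * fgeo ^+ 2); first by ring.
by rewrite E; ring.
Qed.

Lemma fderiv_Y : D fY = 9 * (1 - X) ^+ 2 * fgeo ^+ 4.
Proof.
rewrite /fY fderivM fderivXn fderiv_geo fderivM [D (9 * X)]fderivM.
rewrite fderiv_nat !fderivD fderivX2 fderiv1 fderivX; have m := fgeoP; move: m; set v := fgeo => m.
(* The factor (1 + 2X) v equals 1. Inserted at suitable powers, it leaves identities between
   polynomials in X and v, which [ring] decides; the device recurs below. *)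
transitivity ((9 * (1 + 2 * X + 3 * X ^+ 2)) * v ^+ 3 * ((1 + 2 * X) * v)
  - 54 * X * (1 + X + X ^+ 2) * v ^+ 4).
  by rewrite m; ring.
by ring.
Qed.

Lemma fY_compl : 1 - fY = (1 - X) ^+ 3 * fgeo ^+ 3.
Proof.
have m := fgeoP; rewrite /fY; move: m; set v := fgeo => m.
transitivity (((1 + 2 * X) * v) ^+ 3 - 9 * X * (1 + X + X ^+ 2) * v ^+ 3).
  by rewrite m; ring.
by ring.
Qed.

(** With v = 1 / (1 + 2X) one has Y (1 - Y) = X (1 - X^3) v^2 Y', so the pulled-back equation
    becomes one in the derivative of F(Y) itself. *)
Lemma fhypY_ode : D (X * ((1 - X ^+ 3) * fgeo ^+ 2) * D (fcomp fhyp fY))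
  = 2 * (1 - X) ^+ 2 * fgeo ^+ 4 * fcomp fhyp fY.
Proof.
have := fhyp_comp_ode fY0; rewrite fY_compl.
set Q := fcomp (D fhyp) fY => E.
rewrite fderiv_comp ?fY0 // fderiv_Y -/Q.
(* Index 8 stands for the factor 9 of [fhyp_comp_ode]. *)
apply: (@fmulIn 8).
have -> : X * ((1 - X ^+ 3) * fgeo ^+ 2) * (Q * (9 * (1 - X) ^+ 2 * fgeo ^+ 4))
  = fY * ((1 - X) ^+ 3 * fgeo ^+ 3) * Q by rewrite /fY; ring.
by rewrite E fderiv_Y; ring.
Qed.

Definition fhyp3 := fcomp fhyp (X ^+ 3).

Lemma fhyp3_ode : D (X * (1 - X ^+ 3) * D fhyp3) = 2 * X ^+ 2 * fhyp3.
Proof.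
have := fhyp_comp_ode fX3_0.
rewrite /fhyp3; set Q := fcomp (D fhyp) (X ^+ 3) => E.
rewrite fderiv_comp ?fX3_0 // -/Q.
apply: (@fmulIn 8); rewrite fderivX3 in E *.
have -> : X * (1 - X ^+ 3) * (Q * (3 * X ^+ 2))
  = X ^+ 3 * (1 - X ^+ 3) * Q * 3%:R by ring.
by rewrite fderivM fderiv_nat mulr0 addr0 -mulrnAl E; ring.
Qed.

(** The factor 1 + 2X carries the equation of F(X^3) into the one that F(Y) satisfies in
    [fhypY_ode]. *)
Lemma fhyp3_twist_ode :
  D (X * ((1 - X ^+ 3) * fgeo ^+ 2) * D ((1 + 2 * X) * fhyp3))
  = 2 * (1 - X) ^+ 2 * fgeo ^+ 4 * ((1 + 2 * X) * fhyp3).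
Proof.
have m := fgeoP; have E := fhyp3_ode; have dv := fderiv_geo.
move: m E dv; set v := fgeo; set h := fhyp3 => m E dv.
have -> : X * ((1 - X ^+ 3) * v ^+ 2) * D ((1 + 2 * X) * h) =
  X * (1 - X ^+ 3) * D h * v + X * (1 - X ^+ 3) * v ^+ 2 * h * 2%:R.
  rewrite fderivM fderivD fderivM fderivX fderiv1 fderiv_nat.
  transitivity (X * (1 - X ^+ 3) * D h * v * ((1 + 2 * X) * v)
    + X * (1 - X ^+ 3) * v ^+ 2 * h * 2%:R); first by ring.
  by rewrite m mulr1.
have dX3 : D (1 - X ^+ 3) = - 3 * X ^+ 2.
  by rewrite fderivD fderivN fderiv1 fderivX3; ring.
have dv2 : D (v ^+ 2) = - 4 * v ^+ 3.
  by rewrite fderivXn dv; ring.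
rewrite fderivD [D (_ * v)]fderivM E dv [D (_ * 2%:R)]fderivM fderiv_nat.
rewrite [D (_ * h)]fderivM [D (_ * v ^+ 2)]fderivM [D (X * _)]fderivM.
rewrite dX3 fderivX dv2.
transitivity (2 * X ^+ 2 * h * v * ((1 + 2 * X) * v) ^+ 2
  + 2 * (1 - 4 * X ^+ 3) * v ^+ 2 * h * ((1 + 2 * X) * v)
  - 8 * X * (1 - X ^+ 3) * v ^+ 3 * h).
  by rewrite m; ring.
transitivity (2 * (1 - X) ^+ 2 * v ^+ 3 * h); first by ring.
transitivity (2 * (1 - X) ^+ 2 * v ^+ 3 * h * ((1 + 2 * X) * v)).
  by rewrite m mulr1.
by ring.
Qed.

Theorem cubic_transformation : fcomp fhyp fY = (1 + 2 * X) * fhyp3.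
Proof.
apply/eqP; rewrite -subr_eq0; apply/eqP.
(* The weight (1 - X^3) / (1 + 2X)^2 has constant term 1; both series start with 1, so their
   difference starts with 0. *)
apply: (@fuchs_unique K ((1 - X ^+ 3) * fgeo ^+ 2)
  (2 * (1 - X) ^+ 2 * fgeo ^+ 4)).
- by rewrite /= !(big_ord1, big_ord_recl, big_ord0) /=; ring.
- by rewrite /= !(big_ord1, big_ord_recl, big_ord0) /=; ring.
- have e f g : D (f - g) = D f - D g by rewrite fderivD fderivN.
  by rewrite e mulrBr e fhypY_ode fhyp3_twist_ode mulrBr.
Qed.

Lemma fcoefXn k n : (X ^+ k) n = (n == k)%:R.
Proof.
elim: k n => [|k IH] [|n]; rewrite ?expr0 ?fcoef1 // exprS.
  by rewrite fcoefXM0.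
by rewrite fcoefXMS IH eqSS.
Qed.

Lemma fhyp3E n : fhyp3 n = if (3 %| n)%N then hyp (n %/ 3) else 0.
Proof.
rewrite /fhyp3 (@fcompE _ n.+1) ?fX3_0 //.
case: ifP => [/dvdnP[k ->]|dn].
  rewrite mulnK //.
  have kn : (k < (k * 3).+1)%N by rewrite ltnS leq_pmulr.
  rewrite (bigD1 (Ordinal kn)) //= -exprM fcoefXn [(3 * k)%N]mulnC eqxx mulr1.
  rewrite big1 ?addr0 // => i /negP ik; rewrite -exprM fcoefXn.
  case: eqP => [e|]; rewrite ?mulr0 //; case: ik; apply/eqP/val_inj => /=.
  by lia.
rewrite big1 // => i _; rewrite -exprM fcoefXn.
case: eqP => [e|]; rewrite ?mulr0 //; case/negP: (negbT dn).
by rewrite {1}e dvdn_mulr.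
Qed.

(** The series S(Y(t)). *)
Definition fE := fcomp fhypS fY.

(** By the chain rule t d/dt S(Y) = (F(Y) - 1) t Y' / Y, where t Y' / Y = (1 - t)^3 / ((1 - t^3)(1 +
    2t)); the cubic transformation replaces F(Y). *)
Lemma fE_deriv : (1 - X ^+ 3) * (X * D fE) = (1 - X) ^+ 3 * (fhyp3 - fgeo).
Proof.
have m := fgeoP.
have E1 : fY * D fE = ((1 + 2 * X) * fhyp3 - 1) * D fY.
  rewrite /fE fderiv_comp ?fY0 // mulrA -fcompXM ?fY0 // fderiv_hypS.
  by rewrite fcompD fcompN fcomp1 cubic_transformation.
move: E1; rewrite fderiv_Y /fY; move: m; set v := fgeo; set h := fhyp3 => m E1.
apply: (@fmulIn 8).
transitivity ((9 * X * (1 + X + X ^+ 2) * v ^+ 3 * D fE) *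
   ((1 - X) * (1 + 2 * X) ^+ 3)).
  transitivity ((1 - X ^+ 3) * (X * D fE) * ((1 + 2 * X) * v) ^+ 3 *+ 9).
    by rewrite m expr1n mulr1.
  by ring.
rewrite E1.
transitivity (9 * (1 - X) ^+ 3 * (h * ((1 + 2 * X) * v) - v)
  * ((1 + 2 * X) * v) ^+ 3); first by ring.
by rewrite m; ring.
Qed.

(** The factor 1 - X^3 in [fE_deriv] yields a recurrence in steps of three. Besides b_m, the terms 2
    - 3 (-8)^m are, for m >= 1, the contribution of - t d/dt log (Y(t) / t). *)
Theorem fE_coef3 m : fE (3 * m)%N *+ (3 * m) = hyp m + 2 - 3 * (-8) ^+ m.
Proof.
rewrite -fcoefXderiv; have := fE_deriv.
set c := X * D fE => E.
have c0 : c 0%N = 0 by rewrite /c fcoefXM0.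
elim: m => [|m IH]; first by rewrite muln0 c0 hyp0 expr0; ring.
have := congr1 (fun f : fps K => f (3 * m.+1)%N) E.
have -> : (1 - X ^+ 3) * c = c - X * (X * (X * c)) by ring.
(* Both factors act by shifts, so only exponents 3m to 3m + 3 enter, and F(t^3) vanishes at the
   middle two. *)
have -> : (1 - X) ^+ 3 * (fhyp3 - fgeo) = (fhyp3 - fgeo)
  - (X * (fhyp3 - fgeo)) *+ 3 + (X * (X * (fhyp3 - fgeo))) *+ 3
  - X * (X * (X * (fhyp3 - fgeo))) by ring.
have e3 : (3 * m.+1 = (3 * m).+3)%N by rewrite mulnS.
have F0 : fhyp3 (3 * m)%N = hyp m by rewrite fhyp3E dvdn_mulr // mulKn.
have F3 : fhyp3 (3 * m)%N.+3 = hyp m.+1 by rewrite fhyp3E -e3 dvdn_mulr // mulKn.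
have F1 : fhyp3 (3 * m)%N.+1 = 0.
  by rewrite fhyp3E ifF //; lia.
have F2 : fhyp3 (3 * m)%N.+2 = 0.
  by rewrite fhyp3E ifF //; lia.
rewrite e3 !(fcoefD, fcoefB, fcoefN, fcoefMn, fcoefXMS) F0 F1 F2 F3 IH /=.
rewrite !exprS exprM.
have -> : (-2) ^+ 3 = -8 :> K by ring.
move/eqP; rewrite subr_eq => /eqP ->; ring.
Qed.

End Cubic.

(** * Modulus and logarithm *)

Section Modulus.
Variable R : realType.
Local Notation nc := (@ComplexField.Normc.normc R).
Implicit Types z w : R[i].

Lemma nc_ge0 z : 0 <= nc z.
Proof. by case: z => a b; exact: sqrtr_ge0. Qed.

Lemma nc1 : nc 1 = 1.
Proof. exact: ComplexField.Normc.normc1. Qed.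

Lemma nc0 : nc 0 = 0.
Proof. exact: ComplexField.Normc.normc0. Qed.

Lemma ncM z w : nc (z * w) = nc z * nc w.
Proof. exact: ComplexField.Normc.normcM. Qed.

Lemma ncX z n : nc (z ^+ n) = nc z ^+ n.
Proof. by elim: n => [|n IH]; rewrite ?expr0 ?nc1 // !exprS ncM IH. Qed.

Lemma ncV z : nc z^-1 = (nc z)^-1.
Proof. exact: ComplexField.Normc.normcV. Qed.

Lemma ncN z : nc (- z) = nc z.
Proof. exact: (@normcN R z). Qed.

Lemma ncD z w : nc (z + w) <= nc z + nc w.
Proof. exact: (@le_normcD R z w). Qed.

Lemma ncB z w : nc (z - w) <= nc z + nc w.
Proof. by rewrite -(ncN w) ncD. Qed.

Lemma nc_sum I (r : seq I) (P : pred I) (F : I -> R[i]) :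
  nc (\sum_(i <- r | P i) F i) <= \sum_(i <- r | P i) nc (F i).
Proof.
elim/big_rec2: _ => [|i x y _ IH]; first by rewrite nc0.
by rewrite (le_trans (ncD _ _)) // lerD2l.
Qed.

Lemma nc_eq0 z : (nc z == 0) = (z == 0).
Proof.
apply/eqP/eqP => [|->]; first exact: ComplexField.Normc.eq0_normc.
exact: nc0.
Qed.

Lemma nc_gt0 z : (0 < nc z) = (z != 0).
Proof. by rewrite lt_def nc_ge0 andbT nc_eq0. Qed.

Lemma nc_real (r : R) : nc r%:C%C = `|r|.
Proof. by rewrite /= [0 ^+ 2]expr2 mul0r addr0 sqrtr_sqr. Qed.

Lemma nc_nat n : nc n%:R = n%:R.
Proof.
have -> : n%:R = (n%:R : R)%:C%C by rewrite rmorph_nat.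
by rewrite nc_real normr_nat.
Qed.

Lemma ReD z w : Re (z + w) = Re z + Re w.
Proof. by case: z w => a b []. Qed.

Lemma ReN z : Re (- z) = - Re z.
Proof. by case: z. Qed.

Lemma ReB z w : Re (z - w) = Re z - Re w.
Proof. by rewrite ReD ReN. Qed.

Lemma Re_sum I (r : seq I) (P : pred I) (F : I -> R[i]) :
  Re (\sum_(i <- r | P i) F i) = \sum_(i <- r | P i) Re (F i).
Proof. by elim/big_rec2: _ => // i x y _ <-; rewrite ReD. Qed.

Lemma Re_mulrn z n : Re (z *+ n) = Re z *+ n.
Proof. by elim: n => // n IH; rewrite !mulrS ReD IH. Qed.

Lemma Re_realM (r : R) z : Re (r%:C%C * z) = r * Re z.
Proof. by case: z => a b /=; rewrite mul0r subr0. Qed.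

Lemma Re_divn z n : Re (z / n%:R) = Re z / n%:R.
Proof.
have -> : (n%:R : R[i])^-1 = (n%:R^-1 : R)%:C%C.
  by rewrite fmorphV rmorph_nat.
by rewrite mulrC Re_realM mulrC.
Qed.

Lemma normRe_le z : `|Re z| <= nc z.
Proof.
by case: z => a b /=; rewrite -sqrtr_sqr ler_wsqrtr // lerDl sqr_ge0.
Qed.

Lemma nc_subl z w : nc z - nc w <= nc (z - w).
Proof. by rewrite lerBlDr (le_trans _ (ncD _ _)) // subrK. Qed.

(** The truncated series of - log |1 - s z| as a polynomial in real s. *)
Definition logpoly (z : R[i]) N : {poly R} :=
  \sum_(n < N) (Re (z ^+ n.+1) / n.+1%:R) *: 'X^(n.+1).

(** The polynomial |1 - s z|^2 in real s; half its logarithm is log |1 - s z|. *)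
Definition modpoly (z : R[i]) : {poly R} :=
  (1 - (Re z) *: 'X) ^+ 2 + ((Im z) *: 'X) ^+ 2.

Lemma modpolyE z s : (modpoly z).[s] = nc (1 - s%:C%C * z) ^+ 2.
Proof.
case: z => a b; rewrite /modpoly !hornerE /= sqr_sqrtr ?addr_ge0 ?sqr_ge0 //.
by ring.
Qed.

(* Half the logarithmic derivative of |1 - s z|^2 in the real variable s. *)
Lemma modpoly_deriv z s : nc (1 - s%:C%C * z) != 0 ->
  (modpoly z)^`().[s] / (2 * (modpoly z).[s]) = - Re (z / (1 - s%:C%C * z)).
Proof.
move=> nz.
have : nc (1 - s%:C%C * z) ^+ 2 != 0 by rewrite expf_neq0.
rewrite -modpolyE /modpoly; case: z {nz} => a b.
rewrite derivD !expr2 !derivM !(derivB, derivZ, derivX) -polyC1 derivC !hornerE /=.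
move=> nz.
have e : (1 - (s * a - 0 * b)) ^+ 2 + (0 - (s * b + 0 * a)) ^+ 2
   = (1 - a * s) ^+ 2 + (b * s) ^+ 2 by ring.
rewrite e.
have -> : (1 - a * s) * (1 - a * s) + b * s * b * s
  = (1 - a * s) ^+ 2 + (b * s) ^+ 2 by ring.
set q := (1 - a * s) ^+ 2 + (b * s) ^+ 2.
have q0 : q != 0 by move: nz; congr (_ != 0); rewrite /q; ring.
by field.
Qed.

Lemma logpoly_deriv z N s :
  (logpoly z N)^`().[s] = Re (z * \sum_(n < N) (s%:C%C * z) ^+ n).
Proof.
rewrite /logpoly raddf_sum horner_sum mulr_sumr Re_sum.
apply: eq_bigr => n _ /=.
rewrite derivZ derivXn hornerZ hornerMn hornerXn /=.
have -> : z * (s%:C%C * z) ^+ n = (s ^+ n)%:C%C * z ^+ n.+1.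
  by rewrite exprMn exprS rmorphXn; ring.
rewrite Re_realM -[s ^+ n *+ n.+1]mulr_natr.
have : n.+1%:R != 0 :> R by rewrite pnatr_eq0.
by move: (n.+1%:R : R) => k k0; field.
Qed.

Lemma logpoly0 z N : (logpoly z N).[0] = 0.
Proof.
rewrite /logpoly horner_sum big1 // => n _.
by rewrite hornerZ hornerXn expr0n mulr0.
Qed.

Lemma logpoly1 z N : (logpoly z N).[1] = Re (\sum_(n < N) z ^+ n.+1 / n.+1%:R).
Proof.
rewrite /logpoly horner_sum Re_sum; apply: eq_bigr => n _.
by rewrite hornerZ hornerXn expr1n mulr1 Re_divn.
Qed.

(** The mean value theorem in s, applied to log |1 - s z| plus its truncated series, avoids the
    complex logarithm. The derivative is - Re (z (s z)^N / (1 - s z)), and |1 - s z| >= 1/2 gives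
    the factor 2. *)
Lemma ln_taylor z N : nc z <= 1 / 2 ->
  `|ln (nc (1 - z)) + Re (\sum_(n < N) z ^+ n.+1 / n.+1%:R)|
    <= 2 * nc z ^+ N.+1.
Proof.
move=> z2.
have szle (s : R) : s \in `[0, 1]%R -> nc (s%:C%C * z) <= nc z.
  rewrite in_itv /= => /andP[s0 s1].
  by rewrite ncM nc_real ger0_norm // ler_piMl ?nc_ge0.
have szge (s : R) : s \in `[0, 1]%R -> 1 / 2 <= nc (1 - s%:C%C * z).
  move=> s01; have := nc_subl 1 (s%:C%C * z); rewrite nc1.
  by have := szle s s01; lra.
pose phi (s : R) := 2^-1 * ln (modpoly z).[s] + (logpoly z N).[s].
pose dphi (s : R) := - Re (z / (1 - s%:C%C * z))
  + Re (z * \sum_(n < N) (s%:C%C * z) ^+ n).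
have dphiE (s : R) : s \in `[0, 1]%R -> is_derive s 1 phi (dphi s).
  move=> s01; have q0 : 0 < (modpoly z).[s].
    by rewrite modpolyE exprn_gt0 //; have := szge s s01; lra.
  have d1 := is_derive1_ln q0.
  have d2 : is_derive s 1 (fun x => ln (modpoly z).[x])
     ((modpoly z).[s]^-1 * (modpoly z)^`().[s]).
    exact: (@is_derive1_comp R (@ln R) (horner (modpoly z))).
  have nz : nc (1 - s%:C%C * z) != 0 by have := szge s s01; lra.
  have -> : phi = (2^-1 \*: (fun x => ln (modpoly z).[x])) + horner (logpoly z N).
    by [].
  apply: is_derive_eq.
  rewrite /dphi -modpoly_deriv // logpoly_deriv; congr (_ + _).
  by rewrite invfM /GRing.scale /=; ring.
have cphi : {within `[0, 1], continuous phi}%classic.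
  apply: derivable_within_continuous => s s01.
  by have := dphiE s s01; case.
have dphi_oo (s : R) : s \in `]0, 1[%R -> is_derive s 1 phi (dphi s).
  by move=> s01; apply: dphiE; apply: subset_itv_oo_cc s01.
have [c c01] := MVT_segment ler01 dphi_oo cphi.
rewrite /phi !modpolyE mul0r subr0 mul1r nc1 expr1n ln1 mulr0 add0r logpoly0.
rewrite logpoly1 !subr0 mulr1 lnXn; last first.
  have : (1:R) \in `[0, 1]%R by rewrite in_itv /= ler01 lexx.
  by move/szge; rewrite rmorph1 [1 * z]mul1r; lra.
rewrite -[ln _ *+ 2]mulr_natl mulKf ?pnatr_eq0 // => ->.
rewrite /dphi addrC -ReB.
have nz : 1 - c%:C%C * z != 0.
  by rewrite -nc_gt0; have := szge c c01; lra.
have -> : z * (\sum_(n < N) (c%:C%C * z) ^+ n) - z / (1 - c%:C%C * z)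
   = - (z * (c%:C%C * z) ^+ N / (1 - c%:C%C * z)).
  have := subrX1 (c%:C%C * z) N; set S := \sum_(n < N) _; set t := _ * z.
  move=> e; have -> : t ^+ N = 1 + (t - 1) * S by rewrite -e; ring.
  by field.
rewrite ReN normrN (le_trans (normRe_le _)) //.
rewrite !ncM ncV ncX exprS.
have h1 := szge c c01; have h2 := szle c c01.
have h3 : nc (c%:C%C * z) ^+ N <= nc z ^+ N by rewrite lerXn2r ?nnegrE ?nc_ge0.
have h4 : (nc (1 - c%:C%C * z))^-1 <= 2.
  by rewrite -[leRHS]invrK lef_pV2 ?posrE; lra.
rewrite [leRHS]mulrC; apply: ler_pM => //.
- by rewrite mulr_ge0 ?exprn_ge0 ?nc_ge0.
- by rewrite invr_ge0 nc_ge0.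
- by rewrite ler_wpM2l ?nc_ge0.
Qed.

End Modulus.

(** * Integration over the torus *)

Section Torus.
Variable R : realType.
Local Notation nc := (@ComplexField.Normc.normc R).
Local Notation mu := (@lebesgue_measure R).
Local Notation mu2 := (((@lebesgue_measure R) \x (@lebesgue_measure R))%E).
Local Notation sq := ((`[0, 1] `*` `[0, 1])%classic : set (R * R)).
Local Open Scope classical_set_scope.

Definition Isq (g : R * R -> R) : R := Rintegral mu2 sq g.

(** A class closed under sums and products and integrable on the square, which settles all
    integrability conditions. *)
Definition bmeas (g : R * R -> R) :=
  measurable_fun [set: measurableTypeR R * measurableTypeR R] g
    /\ exists M, forall p, `|g p| <= M.

Lemma measurable_sq : measurable (sq : set (measurableTypeR R * measurableTypeR R)).
Proof. exact: measurableX. Qed.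

Lemma mu_sq : mu2 sq = 1%E.
Proof.
have mu01 : mu (`[0, 1] : set R) = 1%E.
  by rewrite lebesgue_measure_itv /= lte_fin ltr01 sube0.
by rewrite product_measure1E // -[RHS]mul1e; congr (_ * _)%E; exact: mu01.
Qed.

Lemma bmeas_integrable g : bmeas g -> mu2.-integrable sq (EFin \o g).
Proof.
have sq_fin : (mu2 sq < +oo)%E by rewrite mu_sq ltry.
move=> [mg [M gM]]; apply: measurable_bounded_integrable.
- exact: measurable_sq.
- exact: sq_fin.
- exact: measurable_funTS.
- exists M; split; first exact: num_real.
  by move=> x Mx p _; rewrite /= (le_trans (gM p)) // ltW.
Qed.

Lemma bmeas_cst c : bmeas (fun=> c).
Proof. by split; [exact: measurable_cst | exists `|c|]. Qed.

Lemma bmeasD f g : bmeas f -> bmeas g -> bmeas (fun p => f p + g p).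
Proof.
move=> [mf [M fM]] [mg [N gN]]; split; first exact: measurable_funD.
by exists (M + N) => p; rewrite (le_trans (ler_normD _ _)) // lerD.
Qed.

Lemma bmeasM f g : bmeas f -> bmeas g -> bmeas (fun p => f p * g p).
Proof.
move=> [mf [M fM]] [mg [N gN]]; split; first exact: measurable_funM.
by exists (M * N) => p; rewrite normrM ler_pM.
Qed.

Lemma bmeas_sum (I : Type) (r : seq I) (F : I -> R * R -> R) :
  (forall i, bmeas (F i)) -> bmeas (fun p => \sum_(i <- r) F i p).
Proof.
move=> bF; elim: r => [|i r IH].
  have -> : (fun p => \sum_(i <- [::]) F i p) = fun=> 0.
    by apply/funext => p; rewrite big_nil.
  exact: bmeas_cst.
have -> : (fun p => \sum_(j <- i :: r) F j p)
    = fun p => F i p + \sum_(j <- r) F j p.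
  by apply/funext => p; rewrite big_cons.
exact: bmeasD.
Qed.

Lemma Isq_cst c : Isq (fun=> c) = c.
Proof.
have fsq : fine (mu2 sq) = 1 by rewrite mu_sq.
rewrite /Isq Rintegral_cst; last exact: measurable_sq.
by rewrite -[RHS]mulr1; congr (_ * _); exact: fsq.
Qed.

Lemma IsqD f g : bmeas f -> bmeas g -> Isq (fun p => f p + g p) = Isq f + Isq g.
Proof.
move=> bf bg; rewrite /Isq RintegralD //; first exact: measurable_sq.
- exact: bmeas_integrable.
- exact: bmeas_integrable.
Qed.

Lemma IsqZ c f : bmeas f -> Isq (fun p => c * f p) = c * Isq f.
Proof.
move=> bf; rewrite /Isq RintegralZl //; first exact: measurable_sq.
exact: bmeas_integrable.
Qed.

Lemma Isq_sum (I : Type) (r : seq I) (F : I -> R * R -> R) :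
  (forall i, bmeas (F i)) ->
  Isq (fun p => \sum_(i <- r) F i p) = \sum_(i <- r) Isq (F i).
Proof.
move=> bF; elim: r => [|i r IH].
  rewrite big_nil -[RHS](Isq_cst 0); congr Isq.
  by apply/funext => p; rewrite big_nil.
rewrite big_cons -IH -IsqD //; last exact: bmeas_sum.
by congr Isq; apply/funext => p; rewrite big_cons.
Qed.

Lemma Isq_le f g : bmeas f -> bmeas g -> (forall p, f p <= g p) -> Isq f <= Isq g.
Proof.
move=> bf bg fg; apply: le_Rintegral => //; first exact: measurable_sq.
- exact: bmeas_integrable.
- exact: bmeas_integrable.
Qed.

(** The square has area 1, so a uniform bound passes unchanged to the integrals. *)
Lemma Isq_dist f g e : bmeas f -> bmeas g -> (forall p, `|f p - g p| <= e) ->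
  `|Isq f - Isq g| <= e.
Proof.
move=> bf bg fg.
have bge c : bmeas (fun p => g p + c) by apply: bmeasD => //; exact: bmeas_cst.
have h1 : Isq f <= Isq g + e.
  rewrite -[X in _ + X](Isq_cst e) -IsqD //; last exact: bmeas_cst.
  apply: Isq_le => // p; have := fg p; rewrite ler_norml; lra.
have h2 : Isq g + (- e) <= Isq f.
  rewrite -[X in _ + X](Isq_cst (- e)) -IsqD //; last exact: bmeas_cst.
  apply: Isq_le => // p; have := fg p; rewrite ler_norml; lra.
rewrite ler_norml; lra.
Qed.

Lemma Isq_prod (f g : R -> R) : continuous f -> continuous g ->
  (forall x, `|f x| <= 1) -> (forall x, `|g x| <= 1) ->
  bmeas (fun p => f p.1 * g p.2) /\
  Isq (fun p => f p.1 * g p.2)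
   = Rintegral mu `[0, 1] f * Rintegral mu `[0, 1] g.
Proof.
move=> cf cg f1 g1.
have mf : measurable_fun [set: measurableTypeR R] f by exact: continuous_measurable_fun.
have mg : measurable_fun [set: measurableTypeR R] g by exact: continuous_measurable_fun.
have bfg : bmeas (fun p => f p.1 * g p.2).
  apply: bmeasM.
    split; last by exists 1.
    by apply: (measurableT_comp mf); exact: measurable_fst.
  split; last by exists 1.
  by apply: (measurableT_comp mg); exact: measurable_snd.
split => //.
have int1 (h : R -> R) : continuous h -> mu.-integrable `[0, 1] (EFin \o h).
  move=> ch; apply: continuous_compact_integrable; first exact: segment_compact.
  exact: continuous_subspaceT.
(* Extension by zero turns the integral over the square into one over the plane, ready for
   Fubini. *)
rewrite /Isq /Rintegral integral_mkcond /=.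
rewrite -(@integral12_prod_meas1 _ _ _ _ _ mu mu) /=; last first.
  have := bmeas_integrable bfg.
  by move/(integrable_mkcond _ measurable_sq).
pose G : measurableTypeR R -> \bar R :=
  (fun x => ((Rintegral mu `[0%R, 1%R] g)%:E * (f x)%:E)%E) \_ `[0%R, 1%R].
transitivity (fine (\int[mu]_x G x)%E).
  congr fine; apply: eq_integral => x _; rewrite /fubini_F /G [RHS]/patch.
  case: ifPn => [/set_mem x01|/negP x01].
    transitivity (\int[mu]_(y in `[0%R, 1%R]) ((f x)%:E * (g y)%:E))%E.
      rewrite [RHS]integral_mkcond; apply: eq_integral => y _.
      rewrite /patch; congr (if _ then _ else _).
      apply/idP/idP => [/set_mem[_ y01]|/set_mem y01]; exact/mem_set.
    rewrite integralZl //; last exact: int1.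
    by rewrite muleC /Rintegral fineK //; exact: integrable_fin_num (int1 _ cg).
  apply: integral0_eq => y _; rewrite /patch.
  case: ifPn => // xy; have [xx _] := set_mem xy.
  by case: x01; apply/mem_set.
rewrite /G -integral_mkcond /= integralZl //; last exact: int1.
rewrite -[X in (_ * X)%E](@fineK _ (\int[mu]_(x in _) _)%E); last first.
  exact: integrable_fin_num (int1 _ cf).
by rewrite -EFinM /= mulrC.
Qed.

End Torus.

(** * Orthogonality of the characters of the torus *)

Section Characters.
Variable R : realType.
Local Notation mu := (@lebesgue_measure R).
Local Open Scope classical_set_scope.

Lemma Rintegral_FTC (f F : R -> R) : continuous f ->
  (forall x : R, is_derive x (1 : R) F (f x)) ->
  Rintegral mu `[0, 1] f = F 1 - F 0.
Proof.
move=> cf dF.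
have cF : continuous F.
  move=> x; apply: differentiable_continuous; apply/derivable1_diffP.
  by have [] := dF x.
rewrite /Rintegral (@continuous_FTC2 _ f F) ?ltr01 //.
- exact: continuous_subspaceT.
- split; first by move=> x _; have [] := dF x.
  + by apply: cvg_at_right_filter; exact: cF.
  + by apply: cvg_at_left_filter; exact: cF.
- by move=> x _; rewrite derive1E; have [_ ->] := dF x.
Qed.

Lemma is_derive_scaled (f : R -> R) (df c x : R) :
  is_derive (c * x) 1 f df -> is_derive x 1 (fun x => f (c * x)) (df * c).
Proof.
move=> d; apply: (@is_derive1_comp R f ( *%R c)) => //.
have -> : *%R c = c \*: id by [].
by apply: is_derive_eq; rewrite [_ *: _]mulr1.
Qed.

Lemma expiD (s t : R) : expi (s + t) = expi s * expi t.
Proof.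
by rewrite /expi mulrDr cosD sinD; simpc; rewrite [sin _ * _ + _]addrC.
Qed.

Lemma expi0 : expi 0 = 1 :> R[i].
Proof. by rewrite /expi mulr0 cos0 sin0. Qed.

Lemma expi1 : expi 1 = 1 :> R[i].
Proof. by rewrite /expi mulr1 mulr_natl cos2pi sin2pi. Qed.

Lemma expiMn (n : nat) (s : R) : expi (n%:R * s) = expi s ^+ n.
Proof.
elim: n => [|n IH]; first by rewrite mul0r expi0 expr0.
by rewrite -addn1 natrD mulrDl mul1r expiD IH exprD expr1.
Qed.

Lemma expi_int (a : int) : expi a%:~R = 1 :> R[i].
Proof.
have nat_case (n : nat) : expi n%:R = 1 :> R[i].
  by rewrite -[X in expi X]mulr1 expiMn expi1 expr1n.
case: a => n; first by rewrite -pmulrn nat_case.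
have := expiD (Negz n)%:~R (n.+1%:R : R).
rewrite nat_case mulr1 => <-.
by rewrite NegzE mulrNz -pmulrn addNr expi0.
Qed.

Lemma continuous_scaled (f : R -> R) (c : R) : continuous f ->
  continuous (fun x : R => f (c * x)).
Proof.
move=> cf x; apply: continuous_comp; last exact: cf.
by apply: cvgM; [exact: cvg_cst | exact: cvg_id].
Qed.

(** For a nonzero, the antiderivative sin (c x) / c with c = 2 pi a vanishes at both ends, because
    [expi] is 1 at integers. *)
Lemma Rintegral_cos (a : int) :
  Rintegral mu `[0, 1] (fun x => cos (2 * pi * a%:~R * x)) = (a == 0)%:R.
Proof.
have [->|a0] := eqVneq a 0.
  have -> : (fun x : R => cos (2 * pi * 0%:~R * x)) = fun=> 1.
    by apply/funext => x; rewrite mulr0 mul0r cos0.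
  rewrite Rintegral_cst // mul1r -[LHS]/(fine (mu (`[0, 1] : set R))).
  by rewrite lebesgue_measure_itv /= lte_fin ltr01 sube0.
set c := 2 * pi * a%:~R.
have c0 : c != 0.
  by rewrite !mulf_neq0 ?pnatr_eq0 ?intr_eq0 //; exact: lt0r_neq0 (pi_gt0 R).
have d (x : R) : is_derive x (1 : R) (c^-1 \*: (fun x : R => sin (c * x))) (cos (c * x)).
  have d := @is_derive_scaled sin _ c x (is_derive_sin _).
  by apply: is_derive_eq; rewrite /GRing.scale /= mulrCA mulVf // mulr1.
rewrite (Rintegral_FTC (continuous_scaled (@continuous_cos R)) d).
have := expi_int a; rewrite /expi -/c => -[_ s].
by rewrite /= mulr1 s mulr0 sin0 subrr.
Qed.

Lemma Rintegral_sin (a : int) :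
  Rintegral mu `[0, 1] (fun x => sin (2 * pi * a%:~R * x)) = 0.
Proof.
have [->|a0] := eqVneq a 0.
  have -> : (fun x : R => sin (2 * pi * 0%:~R * x)) = fun=> 0.
    by apply/funext => x; rewrite mulr0 mul0r sin0.
  by rewrite Rintegral_cst // mul0r.
set c := 2 * pi * a%:~R.
have c0 : c != 0.
  by rewrite !mulf_neq0 ?pnatr_eq0 ?intr_eq0 //; exact: lt0r_neq0 (pi_gt0 R).
have d (x : R) : is_derive x (1 : R) ((- c^-1) \*: (fun x : R => cos (c * x))) (sin (c * x)).
  have d := @is_derive_scaled cos _ c x (is_derive_cos _).
  apply: is_derive_eq; rewrite /GRing.scale /= mulNr mulNr mulrN opprK.
  by rewrite mulrCA mulVf // mulr1.
rewrite (Rintegral_FTC (continuous_scaled (@continuous_sin R)) d).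
have := expi_int a; rewrite /expi -/c => -[s _].
by rewrite /= mulr1 s mulr0 cos0 subrr.
Qed.

(** The monomial x^a y^b on the torus; integer exponents admit the negative powers in (x^3 + y^3 +
    1) / (xy). *)
Definition ch (a b : int) (p : R * R) : R[i] :=
  expi (a%:~R * p.1 + b%:~R * p.2).

Lemma chD a b c d p : ch a b p * ch c d p = ch (a + c) (b + d) p.
Proof. by rewrite /ch -expiD !rmorphD /=; congr expi; ring. Qed.

Lemma ch0 p : ch 0 0 p = 1.
Proof. by rewrite /ch !mul0r addr0 expi0. Qed.

Lemma chX a b p n : ch a b p ^+ n = ch (a *+ n) (b *+ n) p.
Proof.
elim: n => [|n IH]; first by rewrite expr0 ch0.
by rewrite exprS IH chD !mulrS.
Qed.

Lemma nc_expi (s : R) : ComplexField.Normc.normc (expi s) = 1.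
Proof. by rewrite /= cos2Dsin2 sqrtr1. Qed.

Lemma Isq_ch (c : R[i]) a b :
  bmeas (fun p => Re (c * ch a b p)) /\
  Isq (fun p => Re (c * ch a b p)) = if (a == 0) && (b == 0) then Re c else 0.
Proof.
pose C (a : int) (x : R) := cos (2 * pi * a%:~R * x).
pose S (a : int) (x : R) := sin (2 * pi * a%:~R * x).
have CC e : continuous (C e) by apply: continuous_scaled; exact: continuous_cos.
have CS e : continuous (S e) by apply: continuous_scaled; exact: continuous_sin.
have C1 e x : `|C e x| <= 1 by exact: cos_max.
have S1 e x : `|S e x| <= 1 by exact: sin_max.
have [b1 i1] := Isq_prod (CC a) (CC b) (C1 a) (C1 b).
have [b2 i2] := Isq_prod (CS a) (CS b) (S1 a) (S1 b).
have [b3 i3] := Isq_prod (CS a) (CC b) (S1 a) (C1 b).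
have [b4 i4] := Isq_prod (CC a) (CS b) (C1 a) (S1 b).
have bz k f : bmeas f -> bmeas (fun p : R * R => k * f p).
  by apply: bmeasM; exact: bmeas_cst.
(* The addition formulas split the real part into products of one-variable functions, to which
   [Isq_prod] applies. *)
have -> : (fun p => Re (c * ch a b p)) = fun p => 
   (Re c * (C a p.1 * C b p.2) + (- Re c) * (S a p.1 * S b p.2))
   + ((- Im c) * (S a p.1 * C b p.2) + (- Im c) * (C a p.1 * S b p.2)).
  apply/funext => p; case: c => u v /=; rewrite mulrDr !mulrA cosD sinD.
  by rewrite -/(C a p.1) -/(C b p.2) -/(S a p.1) -/(S b p.2); ring.
split; first by do 2! apply: bmeasD => //; apply: bz.
rewrite !IsqD ?IsqZ ?i1 ?i2 ?i3 ?i4 //; try by [apply: bz | apply: bmeasD; apply: bz].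
rewrite !(Rintegral_cos, Rintegral_sin) !mul0r !mulr0 !addr0 -natrM.
by case: (a == 0); case: (b == 0); rewrite /= ?mulr0 ?mulr1.
Qed.

Lemma Isq_ch_sum (I : Type) (r : seq I) (c : I -> R[i]) (a b : I -> int) :
  let g p := Re (\sum_(i <- r) c i * ch (a i) (b i) p) in
  bmeas g /\
  Isq g = \sum_(i <- r) if (a i == 0) && (b i == 0) then Re (c i) else 0.
Proof.
move=> g.
have -> : g = fun p => \sum_(i <- r) Re (c i * ch (a i) (b i) p).
  by apply/funext => p; rewrite /g Re_sum.
have bi i := proj1 (Isq_ch (c i) (a i) (b i)).
split; first exact: bmeas_sum.
rewrite Isq_sum //; apply: eq_bigr => i _.
exact: (proj2 (Isq_ch (c i) (a i) (b i))).
Qed.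

End Characters.

(** * The Mahler measure for a large parameter *)

Section Mahler.
Variable R : realType.
Local Notation nc := (@ComplexField.Normc.normc R).
Local Notation sq := ((`[0, 1] `*` `[0, 1])%classic : set (R * R)).

(* (x^3 + y^3 + 1) / (xy) on the torus. *)
Definition hesse (p : R * R) : R[i] := ch 2 (-1) p + (ch (-1) 2 p + ch (-1) (-1) p).

(* The constant term of the n-th power of (x^3 + y^3 + 1) / (xy). *)
Definition moment n : nat := if (3 %| n)%N then trinom (n %/ 3) else 0.

(** Two nested binomial expansions, flattened to one sum over a list of pairs so that [Isq_ch_sum]
    applies. *)
Lemma hesseX (c : R[i]) n p : c * hesse p ^+ n =
  \sum_(q <- [seq (i, j) | i <- iota 0 n.+1, j <- iota 0 i.+1])
    (c *+ ('C(n, q.1) * 'C(q.1, q.2))) *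
    ch (2 *+ (n - q.1) + ((-1) *+ (q.1 - q.2) + (-1) *+ q.2))
       ((-1) *+ (n - q.1) + (2 *+ (q.1 - q.2) + (-1) *+ q.2)) p.
Proof.
rewrite big_allpairs_dep /hesse exprDn mulr_sumr -(big_mkord xpredT (fun i =>
  c * (ch 2 (-1) p ^+ (n - i) * (ch (-1) 2 p + ch (-1) (-1) p) ^+ i *+ 'C(n, i)))).
rewrite /index_iota subn0; apply: eq_bigr => i _.
rewrite exprDn mulr_sumr -sumrMnl mulr_sumr -(big_mkord xpredT (fun j =>
  c * (ch 2 (-1) p ^+ (n - i) *
   (ch (-1) 2 p ^+ (i - j) * ch (-1) (-1) p ^+ j *+ 'C(i, j)) *+ 'C(n, i)))).
rewrite /index_iota subn0; apply: eq_bigr => j _ /=.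
rewrite !chX -!chD; ring.
Qed.

Lemma sum_single (I : eqType) (r : seq I) (x : I) (F : I -> R) :
  uniq r -> x \in r -> (forall i, i != x -> F i = 0) -> \sum_(i <- r) F i = F x.
Proof.
move=> ur xr F0; rewrite (bigD1_seq x) //= big1 ?addr0 //.
Qed.

Lemma Isq_hesse (c : R[i]) n :
  bmeas (fun p => Re (c * hesse p ^+ n)) /\
  Isq (fun p => Re (c * hesse p ^+ n)) = Re c * (moment n)%:R.
Proof.
have -> : (fun p => Re (c * hesse p ^+ n)) = fun p => Re (\sum_(q <-
    [seq (i, j) | i <- iota 0 n.+1, j <- iota 0 i.+1])
    (c *+ ('C(n, q.1) * 'C(q.1, q.2))) *
    ch (2 *+ (n - q.1) + ((-1) *+ (q.1 - q.2) + (-1) *+ q.2))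
       ((-1) *+ (n - q.1) + (2 *+ (q.1 - q.2) + (-1) *+ q.2)) p).
  by apply/funext => p; rewrite hesseX.
set r := [seq _ | _ <- _, _ <- _].
have [b i] := Isq_ch_sum r (fun q => c *+ ('C(n, q.1) * 'C(q.1, q.2)))
  (fun q => 2 *+ (n - q.1) + ((-1) *+ (q.1 - q.2) + (-1) *+ q.2))
  (fun q => (-1) *+ (n - q.1) + (2 *+ (q.1 - q.2) + (-1) *+ q.2)).
split; first exact: b.
rewrite i {b i} /r big_allpairs_dep.
(* Under these bounds no subtraction is truncated, and both exponents vanish exactly when n - i = i
   - j = j = n / 3. *)
have cond (i j : nat) : (i <= n)%N -> (j <= i)%N ->
  ((2 : int) *+ (n - i) + ((-1) *+ (i - j) + (-1) *+ j) == 0) &&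
  ((-1 : int) *+ (n - i) + (2 *+ (i - j) + (-1) *+ j) == 0)
  = ((3 * i == 2 * n) && (3 * j == n))%N.
  move=> i_n ji; apply/idP/idP; lia.
rewrite (eq_big_seq (fun i => \sum_(j <- iota 0 i.+1)
    if ((3 * i == 2 * n) && (3 * j == n))%N
    then Re (c *+ ('C(n, i) * 'C(i, j))) else 0)); last first.
  move=> i; rewrite mem_iota add0n ltnS => /andP[_ i_n].
  apply: eq_big_seq => j; rewrite mem_iota add0n ltnS => /andP[_ ji].
  by rewrite [X in if X then _ else _]cond.
rewrite /moment; case: ifP => [/dvdnP[m nm]|n3]; last first.
  rewrite mulr0 big1 // => i _; rewrite big1 // => j _; case: ifP => //.
  by case/andP => _ /eqP jn; move: n3; rewrite -jn dvdn_mulr.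
rewrite nm mulnK //.
rewrite (@sum_single _ _ (2 * m)%N) ?iota_uniq //; first last.
- move=> i im; rewrite big1 // => j _; case: ifP => // /andP[/eqP e _].
  by case/eqP: im; lia.
- by rewrite mem_iota; lia.
rewrite (@sum_single _ _ m) ?iota_uniq //; first last.
- by move=> j jm; case: ifP => // /andP[_ /eqP e]; case/eqP: jm; lia.
- by rewrite mem_iota; lia.
have -> : ((3 * (2 * m) == 2 * (m * 3)) && (3 * m == m * 3))%N.
  by apply/andP; split; apply/eqP; lia.
by rewrite /trinom [(m * 3)%N]mulnC Re_mulrn mulr_natr.
Qed.

Lemma nc_ch a b p : nc (ch a b p) = 1.
Proof. exact: nc_expi. Qed.

Lemma nc_hesse p : nc (hesse p) <= 3.
Proof.
rewrite /hesse (le_trans (ncD _ _)) // nc_ch.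
by have := ncD (ch (-1) 2 p) (ch (-1) (-1) p); rewrite !nc_ch; lra.
Qed.

(** The factor k x y has modulus |k| on the torus, so it contributes only log |k| to the Mahler
    measure. *)
Lemma hesse_factor (k : R[i]) p : k != 0 ->
  expi p.1 ^+ 3 + expi p.2 ^+ 3 + 1 - k * expi p.1 * expi p.2
  = - (k * ch 1 1 p * (1 - k^-1 * hesse p)).
Proof.
move=> k0.
have -> : expi p.1 = ch 1 0 p by rewrite /ch mul1r mul0r addr0.
have -> : expi p.2 = ch 0 1 p by rewrite /ch mul1r mul0r add0r.
rewrite -[k * _ * _]mulrA chD !chX.
have -> : - (k * ch 1 1 p * (1 - k^-1 * hesse p)) =
  k / k * (ch 1 1 p * hesse p) - k * ch 1 1 p by ring.
rewrite mulfV // mul1r /hesse !mulrDr !chD.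
have -> : (1 : int) *+ 3 = 3 by [].
have -> : (0 : int) *+ 3 = 0 by [].
rewrite -(ch0 p); congr (_ - k * _).
by rewrite addrA; congr (ch _ _ p + ch _ _ p + ch _ _ p).
Qed.

Lemma bmeas_comp_Re (c d : R[i]) : bmeas (fun p => Re (c + d * hesse p)).
Proof.
have -> : (fun p => Re (c + d * hesse p))
    = fun p => Re c + Re (d * hesse p ^+ 1).
  by apply/funext => p; rewrite ReD expr1.
by apply: bmeasD; [exact: bmeas_cst | exact: (proj1 (Isq_hesse d 1))].
Qed.

Lemma ImE (z : R[i]) : Im z = Re (- 'i%C * z).
Proof. by case: z => a b /=; rewrite oppr0 mul0r mulN1r opprK add0r. Qed.

Lemma bmeas_ln (k : R[i]) : 6 <= nc k ->
  bmeas (fun p => ln (nc (1 - k^-1 * hesse p))) /\ (forall p, nc (k^-1 * hesse p) <= 1 / 2).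
Proof.
move=> k6.
have h p : nc (k^-1 * hesse p) <= 1 / 2.
  rewrite ncM ncV mulrC ler_pdivrMr; last by lra.
  by have := nc_hesse p; lra.
split => //; split; last first.
  (* With no Taylor term, [ln_taylor] bounds the logarithm by 2 * (1/2) = 1. *)
  exists 1 => p; have := ln_taylor 0 (h p); rewrite big_ord0 addr0 expr1.
  by have := h p; lra.
pose re p := Re (1 - k^-1 * hesse p).
pose im p := Im (1 - k^-1 * hesse p).
have mre : measurable_fun [set: measurableTypeR R * measurableTypeR R]%classic re.
  have -> : re = fun p => Re (1 + (- k^-1) * hesse p).
    by apply/funext => p; rewrite mulNr.
  exact: (proj1 (bmeas_comp_Re _ _)).
have mim : measurable_fun [set: measurableTypeR R * measurableTypeR R]%classic im.
  have -> : im = fun p => Re (- 'i%C + ('i%C * k^-1) * hesse p).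
    by apply/funext => p; rewrite /im ImE; congr Re; ring.
  exact: (proj1 (bmeas_comp_Re _ _)).
(* Half the logarithm of a sum of two squares is a composite of measurable real functions. *)
have -> : (fun p => ln (nc (1 - k^-1 * hesse p)))
    = (fun p => 2^-1 * ln (re p ^+ 2 + im p ^+ 2)).
  apply/funext => p.
  have q : 0 < nc (1 - k^-1 * hesse p).
    by have := nc_subl 1 (k^-1 * hesse p); rewrite nc1; have := h p; lra.
  have -> : re p ^+ 2 + im p ^+ 2 = nc (1 - k^-1 * hesse p) ^+ 2.
    rewrite /re /im; case: (1 - _) => a b /=.
    by rewrite sqr_sqrtr // addr_ge0 ?sqr_ge0.
  by rewrite lnXn // -[ln _ *+ 2]mulr_natl mulKf ?pnatr_eq0.
apply: measurable_funM; first exact: measurable_cst.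
apply: (measurableT_comp (@measurable_ln R)).
by apply: measurable_funD; exact: measurable_funX.
Qed.

(** Since |w| <= 3, the bound |k| >= 6 gives |w / k| <= 1/2. Integrating [ln_taylor] termwise
    produces the moments, with error 2 (1/2)^(N+1). *)
Lemma Nk_expand (k : R[i]) N : 6 <= nc k ->
  `|Nk k - (ln (nc k)
     - \sum_(n < N) (moment n.+1)%:R / n.+1%:R * Re (k^-1 ^+ n.+1))|
  <= (1 / 2) ^+ N.
Proof.
move=> k6; have k0 : k != 0 by rewrite -nc_gt0; lra.
have [bl h] := bmeas_ln k6.
pose L p := ln (nc (1 - k^-1 * hesse p)).
have -> : Nk k = Isq (fun p => ln (nc k) + L p).
  rewrite /Nk /mahler2 /Isq; apply: eq_Rintegral => p _.
  rewrite hesse_factor // ncN !ncM nc_ch mulr1 lnM // posrE; first by lra.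
  by have := nc_subl 1 (k^-1 * hesse p); rewrite nc1; have := h p; lra.
rewrite IsqD ?Isq_cst //; last exact: bmeas_cst.
pose T p := \sum_(n < N) n.+1%:R^-1 * Re ((k^-1) ^+ n.+1 * hesse p ^+ n.+1).
have bT : bmeas T.
  apply: bmeas_sum => n; apply: bmeasM; first exact: bmeas_cst.
  exact: (proj1 (Isq_hesse _ _)).
have iT : Isq T = \sum_(n < N) (moment n.+1)%:R / n.+1%:R * Re (k^-1 ^+ n.+1).
  rewrite Isq_sum; last first.
    move=> n; apply: bmeasM; first exact: bmeas_cst.
    exact: (proj1 (Isq_hesse _ _)).
  apply: eq_bigr => n _; rewrite IsqZ; last exact: (proj1 (Isq_hesse _ _)).
  by rewrite (proj2 (Isq_hesse _ _)); ring.
have bT' : bmeas (fun p => (-1) * T p) by apply: bmeasM => //; exact: bmeas_cst.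
have -> : ln (nc k) + Isq L - (ln (nc k)
    - \sum_(n < N) (moment n.+1)%:R / n.+1%:R * Re (k^-1 ^+ n.+1))
  = Isq L - Isq (fun p => (-1) * T p).
  by rewrite IsqZ // iT; ring.
apply: Isq_dist => // p.
have -> : L p - -1 * T p = ln (nc (1 - k^-1 * hesse p))
   + Re (\sum_(n < N) (k^-1 * hesse p) ^+ n.+1 / n.+1%:R).
  rewrite mulN1r opprK Re_sum; congr (_ + _); apply: eq_bigr => n _.
  by rewrite Re_divn exprMn mulrC.
rewrite (le_trans (ln_taylor N (h p))) //.
rewrite exprS mulrA; have h' := h p.
rewrite -[leRHS]mul1r; apply: ler_pM.
- by rewrite mulr_ge0 ?nc_ge0.
- by rewrite exprn_ge0 ?nc_ge0.
- by lra.
- by rewrite lerXn2r ?nnegrE ?nc_ge0.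
Qed.

End Mahler.

(** * Expansion of n(t) for small t *)

Section NfunExpansion.
Variable R : realType.
Local Notation nc := (@ComplexField.Normc.normc R).
Local Notation s_ := (fhypS R[i]).

Lemma cbrtK (t : R[i]) : cbrt t ^+ 3 = t.
Proof.
(* A cube root exists, so the default value of [xget] never occurs. *)
rewrite /cbrt; case: xgetP => [s _ //|/(_ (3.-root t)%C)].
by case; rewrite /= rootCK.
Qed.

Lemma moment_sum (g : nat -> R) M :
  \sum_(n < 3 * M) (moment n.+1)%:R / n.+1%:R * g n.+1
  = \sum_(m < M) (trinom m.+1)%:R / (3 * m.+1)%:R * g (3 * m.+1)%N.
Proof.
elim: M => [|M IH]; first by rewrite muln0 !big_ord0.
have -> : (3 * M.+1 = (3 * M).+3)%N by lia.
rewrite !big_ord_recr /= IH -!addrA; congr (_ + _).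
have -> : (3 * M.+1 = (3 * M).+3)%N by lia.
rewrite /moment; have -> : (3 %| (3 * M).+1)%N = false by lia.
have -> : (3 %| (3 * M).+2)%N = false by lia.
have -> : (3 %| (3 * M).+3)%N by lia.
have -> : ((3 * M).+3 %/ 3 = M.+1)%N by lia.
by rewrite !mul0r !add0r.
Qed.

(** For k = 3 / s with s^3 = t, k^-3 = t / 27 and log |k| = log 3 - log |t| / 3, so the choice of s
    drops out. The bound |t| <= 1/8 gives |k| >= 6. *)
Lemma nfun_expand (t : R[i]) M : 0 < nc t <= 1 / 8 ->
  `|3 * nfun t - (3 * ln 3 - ln (nc t)
      - Re (\sum_(m < M.+1) s_ m * t ^+ m))| <= 3 * (1 / 2) ^+ M.
Proof.
move=> /andP[t0 t8]; rewrite /nfun.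
have := cbrtK t; set s := cbrt t => st.
have st' : nc t = nc s ^+ 3 by rewrite -st ncX.
have s0 : 0 < nc s.
  rewrite lt_def nc_ge0 andbT; apply/eqP => s0.
  by move: t0; rewrite st' s0 expr0n /= ltxx.
have s2 : nc s <= 1 / 2.
  rewrite leNgt; apply/negP => s2.
  have : (1 / 2) ^+ 3 < nc s ^+ 3 by rewrite ltrXn2r // nnegrE; lra.
  have -> : (1 / 2) ^+ 3 = 1 / 8 :> R by field.
  by rewrite -st'; lra.
have kE : nc (3 / s) = 3 / nc s by rewrite ncM ncV nc_nat.
have k6 : 6 <= nc (3 / s) by rewrite kE ler_pdivlMr //; lra.
have := Nk_expand (3 * M) k6; rewrite (moment_sum (fun n => Re ((3 / s)^-1 ^+ n))).
have -> : ln (nc (3 / s)) = ln 3 - ln (nc t) / 3.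
  rewrite kE ln_div ?posrE // st' lnXn //. by rewrite -[ln _ *+ 3]mulr_natr; field.
rewrite (_ : \sum_(m < M) _ = Re (\sum_(m < M.+1) s_ m * t ^+ m) / 3); last first.
  (* The index-0 coefficient of S is 0, which absorbs the shift from M + 1 terms to M. *)
  rewrite big_ord_recl /= invr0 mulr0 mul0r add0r Re_sum mulr_suml.
  apply: eq_bigr => m _.
  have -> : (3 / s)^-1 ^+ (3 * m.+1) = t ^+ m.+1 / 27 ^+ m.+1.
    rewrite exprM -expr_div_n; congr (_ ^+ _).
    by rewrite -st invf_div expr_div_n; congr (_ / _); ring.
  set X := t ^+ m.+1 / _.
  have -> : hyp R[i] (bump 0 m) / (bump 0 m)%:R * t ^+ bump 0 m
     = (X *+ trinom m.+1) / m.+1%:R.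
    by rewrite /X /hyp /bump /= add1n -[_ *+ trinom _]mulr_natr; ring.
  rewrite Re_divn Re_mulrn -[_ *+ trinom _]mulr_natr natrM invfM; ring.
have e : (1 / 2) ^+ (3 * M) <= (1 / 2) ^+ M :> R.
  by apply: ler_wiXn2l; [lra | lra | lia].
rewrite !ler_norml; lra.
Qed.

End NfunExpansion.

(** * Evaluation of power series *)

Section Evaluation.
Variable R : realType.
Local Notation nc := (@ComplexField.Normc.normc R).
Variables (r q : R) (u : R[i]).
Hypotheses (r0 : 0 < r) (q0 : 0 <= q) (q1 : q <= 1) (urq : nc u <= r * q).

Definition fnorm (f : fps R[i]) N := \sum_(n < N) nc (f n) * r ^+ n.
Definition feval (f : fps R[i]) N := \sum_(n < N) f n * u ^+ n.

(* B bounds the weighted l1-norm of f on the disc of radius r, and v is the sum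
   of f at u, with the geometric rate given by |u| <= r q. *)
Definition evals (f : fps R[i]) (B : R) (v : R[i]) :=
  forall N, fnorm f N <= B /\ nc (v - feval f N) <= B * q ^+ N.

Lemma fnorm_ge0 f N : 0 <= fnorm f N.
Proof. by apply: sumr_ge0 => n _; rewrite mulr_ge0 ?nc_ge0 ?exprn_ge0 ?ltW. Qed.

Lemma evals_ge0 f B v : evals f B v -> 0 <= B.
Proof. by move=> /(_ 0%N)[+ _]; apply: le_trans; exact: fnorm_ge0. Qed.

Lemma evals_le f B B' v : B <= B' -> evals f B v -> evals f B' v.
Proof.
move=> BB ev N; have [h1 h2] := ev N; split; first exact: le_trans BB.
by rewrite (le_trans h2) // ler_wpM2r // exprn_ge0.
Qed.

Lemma evals_bound f B v : evals f B v -> nc v <= B.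
Proof.
by move=> /(_ 0%N)[_]; rewrite /feval big_ord0 subr0 expr0 mulr1.
Qed.

Lemma evalsD f g B C v w : evals f B v -> evals g C w ->
  evals (f + g) (B + C) (v + w).
Proof.
move=> ef eg N; have [f1 f2] := ef N; have [g1 g2] := eg N; split.
  apply: le_trans (lerD f1 g1); rewrite /fnorm -big_split /=.
  apply: ler_sum => n _; rewrite -mulrDl ler_wpM2r ?ncD //.
  by rewrite exprn_ge0 // ltW.
have -> : v + w - feval (f + g) N = (v - feval f N) + (w - feval g N).
  have -> : feval (f + g) N = feval f N + feval g N.
    by rewrite /feval -big_split /=; apply: eq_bigr => n _; rewrite mulrDl.
  by ring.
by rewrite (le_trans (ncD _ _)) // mulrDl lerD.
Qed.

Lemma evals1 : evals 1 1 1.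
Proof.
case=> [|N]; rewrite /fnorm /feval.
  by rewrite !big_ord0 subr0 nc1 expr0 mulr1.
have z n : (1 : fps R[i]) n.+1 = 0 by [].
rewrite !big_ord_recl !big1 => [|i _|i _]; first last.
- by rewrite lift0 z nc0 mul0r.
- by rewrite lift0 z mul0r.
rewrite fcoef1 eqxx mulr1n nc1 !expr0 !mulr1 !addr0 subrr nc0 mul1r.
by rewrite exprn_ge0.
Qed.

Lemma evalsX : evals fX r u.
Proof.
have z0 : (fX : fps R[i]) 0%N = 0 by [].
case=> [|[|N]]; rewrite /fnorm /feval.
- rewrite !big_ord0 subr0 expr0 mulr1; split; first exact: ltW.
  by rewrite (le_trans urq) // ler_piMr // ltW.
- rewrite !big_ord1 z0 nc0 !mul0r subr0 expr1; split => //; exact: ltW.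
have z n : (fX : fps R[i]) n.+2 = 0 by [].
have z1 : (fX : fps R[i]) 1%N = 1 by [].
rewrite !big_ord_recl !big1 => [|i _|i _]; first last.
- by rewrite !lift0 z nc0 mul0r.
- by rewrite !lift0 z mul0r.
rewrite lift0 z0 z1 nc1 nc0 !mul0r !addr0 !add0r !mul1r !expr1 subrr nc0.
by split => //; rewrite mulr_ge0 ?exprn_ge0 // ltW.
Qed.

Lemma evalsMn f B v k : evals f B v -> evals (f *+ k) (B *+ k) (v *+ k).
Proof.
move=> ef; elim: k => [|k IH]; last by rewrite !mulrS; apply: evalsD.
move=> N; rewrite !mulr0n mul0r; split.
  by rewrite /fnorm big1 // => n _; rewrite fcoef0 nc0 mul0r.
by rewrite /feval big1 ?subr0 ?nc0 // => n _; rewrite fcoef0 mul0r.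
Qed.

Lemma sum_triangle (V : nmodType) (F : nat -> nat -> V) N :
  \sum_(n < N) \sum_(i < n.+1) F i (n - i)%N
  = \sum_(i < N) \sum_(j < N - i) F i j.
Proof.
elim: N => [|N IH]; first by rewrite !big_ord0.
rewrite big_ord_recr /= IH [in RHS]big_ord_recr /= subSn // subnn big_ord1.
rewrite [X in _ + X]big_ord_recr /= subnn addrA; congr (_ + _).
rewrite -big_split /=; apply: eq_bigr => i _.
by rewrite subSn ?big_ord_recr //= ltnW.
Qed.

(** The weighted norm is submultiplicative; the 2 comes from the error, where the tail of each
    factor contributes B C q^N. *)
Lemma evalsM f g B C v w : evals f B v -> evals g C w ->
  evals (f * g) (2 * B * C) (v * w).
Proof.
move=> ef eg N.
have B0 := evals_ge0 ef; have C0 := evals_ge0 eg.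
have BC0 : 0 <= B * C by rewrite mulr_ge0.
have rn n : 0 <= r ^+ n by rewrite exprn_ge0 // ltW.
have [f1 f2] := ef N; split.
  suff : fnorm (f * g) N <= B * C by rewrite -mulrA; lra.
  apply: (@le_trans _ _ (\sum_(n < N) \sum_(i < n.+1)
      (nc (f i) * r ^+ i) * (nc (g (n - i)%N) * r ^+ (n - i)))).
    apply: ler_sum => n _; rewrite fcoefM.
    apply: le_trans (ler_wpM2r (rn n) (nc_sum _ _ _)) _.
    rewrite mulr_suml; apply: ler_sum => i _.
    rewrite ncM; have -> : r ^+ n = r ^+ (n - i) * r ^+ i.
      by rewrite -exprD subnK // -ltnS.
    by rewrite le_eqVlt; apply/orP; left; apply/eqP; ring.
  rewrite (sum_triangle (fun i j => (nc (f i) * r ^+ i) * (nc (g j) * r ^+ j))).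
  apply: (@le_trans _ _ (\sum_(i < N) (nc (f i) * r ^+ i) * C)).
    apply: ler_sum => i _; rewrite -mulr_sumr ler_wpM2l //.
      by rewrite mulr_ge0 ?nc_ge0.
    by have [] := eg (N - i)%N.
  by rewrite -mulr_suml ler_wpM2r.
(* The triangle i + j < N is cut into rows: row i leaves the tail of g from N - i on, and |u|^i <=
   r^i q^i restores the rate q^N. *)
have -> : v * w - feval (f * g) N = (v - feval f N) * w
    + \sum_(i < N) f i * u ^+ i * (w - feval g (N - i)).
  have -> : feval (f * g) N
     = \sum_(n < N) \sum_(i < n.+1) (f i * u ^+ i) * (g (n - i)%N * u ^+ (n - i)).
    apply: eq_bigr => n _; rewrite fcoefM mulr_suml; apply: eq_bigr => i _.
    have -> : u ^+ n = u ^+ (n - i) * u ^+ i by rewrite -exprD subnK // -ltnS.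
    by ring.
  rewrite (sum_triangle (fun i j => (f i * u ^+ i) * (g j * u ^+ j))).
  under [X in _ = _ + X]eq_bigr do rewrite mulrBr.
  rewrite sumrB -mulr_suml -/(feval f N).
  under [X in _ = _ + (_ - X)]eq_bigr do rewrite mulr_sumr.
  by ring.
rewrite (le_trans (ncD _ _)) //.
have -> : 2 * B * C * q ^+ N = B * q ^+ N * C + B * (C * q ^+ N) by ring.
apply: lerD.
  by rewrite ncM ler_pM ?nc_ge0 // (evals_bound eg).
rewrite (le_trans (nc_sum _ _ _)) //.
apply: (@le_trans _ _ (\sum_(i < N) (nc (f i) * r ^+ i) * (C * q ^+ N))).
  apply: ler_sum => i _; rewrite !ncM ncX -!mulrA ler_wpM2l ?nc_ge0 //.
  have [_ g2] := eg (N - i)%N.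
  have ui : nc u ^+ i <= r ^+ i * q ^+ i.
    by rewrite -exprMn lerXn2r ?nnegrE ?nc_ge0 // mulr_ge0 // ltW.
  have -> : r ^+ i * (C * q ^+ N) = (r ^+ i * q ^+ i) * (C * q ^+ (N - i)).
    have -> : q ^+ N = q ^+ (N - i) * q ^+ i by rewrite -exprD subnK // ltnW.
    by ring.
  by apply: ler_pM => //; rewrite ?exprn_ge0 ?nc_ge0.
by rewrite -mulr_suml ler_wpM2r // mulr_ge0 ?exprn_ge0.
Qed.

Hypothesis r4 : r <= 1 / 4.

Lemma nc_1D2u : 1 / 2 <= nc (1 + 2 * u).
Proof.
have := nc_subl 1 (- (2 * u)); rewrite opprK ncN ncM nc1 nc_nat.
have : r * q <= 1 / 4 by rewrite (le_trans _ r4) // ler_piMr // ltW.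
by have := urq; lra.
Qed.

(** As r <= 1/4, the norm is dominated by the sum of 2^-n, and the tail is exactly (-2u)^N / (1 +
    2u). *)
Lemma evals_geo : evals (fgeo R[i]) 2 (1 + 2 * u)^-1.
Proof.
have h := nc_1D2u; have nz : 1 + 2 * u != 0 by rewrite -nc_gt0; lra.
have nc2 n : nc ((-2) ^+ n) = 2 ^+ n by rewrite ncX ncN nc_nat.
move=> N; split.
  apply: (@le_trans _ _ (\sum_(n < N) (1 / 2) ^+ n)).
    apply: ler_sum => n _; rewrite [fgeo _ _]/= nc2 -exprMn.
    by apply: lerXn2r; rewrite ?nnegrE; have := r4; have := r0; lra.
  have := subrX1 (1 / 2 : R) N; set S := \sum_(n < N) _ => e.
  have : 0 <= (1 / 2 : R) ^+ N by rewrite exprn_ge0 //; lra.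
  by lra.
have -> : (1 + 2 * u)^-1 - feval (fgeo R[i]) N
    = (-2 * u) ^+ N / (1 + 2 * u).
  have -> : feval (fgeo R[i]) N = \sum_(n < N) (-2 * u) ^+ n.
    by apply: eq_bigr => n _; rewrite exprMn.
  have := subrX1 (-2 * u) N; set S := \sum_(n < N) _ => e.
  have -> : (-2 * u) ^+ N = 1 + (-2 * u - 1) * S by rewrite -e; ring.
  by field.
rewrite ncM ncV ncX ncM ncN nc_nat mulrC; apply: ler_pM.
- by rewrite invr_ge0 nc_ge0.
- by rewrite exprn_ge0 // mulr_ge0 ?nc_ge0.
- by rewrite -[leRHS]invrK lef_pV2 ?posrE; lra.
rewrite lerXn2r ?nnegrE ?mulr_ge0 ?nc_ge0 //.
have : r * q <= 1 / 4 * q by rewrite ler_wpM2r.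
by have := urq; have := q0; lra.
Qed.

Lemma evals_Y : evals (fY R[i]) (2304 * r) (Yfun u).
Proof.
have nz : 1 + 2 * u != 0 by rewrite -nc_gt0; have := nc_1D2u; lra.
have -> : fY R[i] = (fX *+ 9 * (1 + fX + fX * fX)) * (fgeo R[i] * (fgeo R[i] * fgeo R[i])).
  by rewrite /fY; ring.
have -> : Yfun u = ((u *+ 9) * (1 + u + u * u)) *
   ((1 + 2 * u)^-1 * ((1 + 2 * u)^-1 * (1 + 2 * u)^-1)).
  by rewrite /Yfun; field.
have g := evals_geo; have x := evalsX; have o := evals1.
have e1 := evalsD (evalsD o x) (evalsM x x).
have e1' : evals (1 + fX + fX * fX) 2 (1 + u + u * u).
  apply: evals_le e1; have : r * r <= 1 / 4 * r by rewrite ler_wpM2r // ltW.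
  by have := r4; lra.
(* A factor 2 from 1 + X + X^2, from each of three geometric series and from each of four products
   gives 9 * 2^8 = 2304. *)
have e2 := evalsM (evalsM (evalsMn 9 x) e1') (evalsM g (evalsM g g)).
by apply: evals_le e2; rewrite -[r *+ 9]mulr_natr; lra.
Qed.

Hypothesis rY : 2304 * r <= 1 / 8.

(** Each product costs a factor 2, and 2 * 2304 r <= 1/4 stays below the ratio 1/2. *)
Lemma evals_YX m : evals (fY R[i] ^+ m) ((1 / 2) ^+ m) (Yfun u ^+ m).
Proof.
elim: m => [|m IH]; first by rewrite !expr0; exact: evals1.
rewrite exprS [Yfun u ^+ _]exprS.
apply: evals_le (evalsM evals_Y IH).
have h : 0 <= (1 / 2 : R) ^+ m by rewrite exprn_ge0 //; lra.
by rewrite exprS; apply: ler_wpM2r => //; have := rY; have := r0; lra.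
Qed.

(** The ratio (3m + 1)(3m + 2) / (9 (m + 1)^2) in [hypS] is at most 1. *)
Lemma hyp_le1 m : nc (hyp R[i] m) <= 1.
Proof.
elim: m => [|m IH]; first by rewrite hyp0 nc1.
have e := congr1 (@ComplexField.Normc.normc R) (hypS R[i] m).
move: e; rewrite [nc (_ * hyp _ m.+1)]ncM [nc (9 * _)]ncM ncX.
rewrite [nc (_ * hyp _ m)]ncM [nc ((_ + _) * _)]ncM !nc_nat.
have -> : nc (3 * m%:R + 1) = 3 * m%:R + 1.
  have -> : 3 * m%:R + 1 = (3 * m + 1)%N%:R :> R[i] by rewrite natrD natrM.
  by rewrite nc_nat natrD natrM.
have -> : nc (3 * m%:R + 2) = 3 * m%:R + 2.
  have -> : 3 * m%:R + 2 = (3 * m + 2)%N%:R :> R[i] by rewrite natrD natrM.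
  by rewrite nc_nat natrD natrM.
have m0 : 0 <= m%:R :> R by [].
rewrite -[m.+1%:R]natr1; move: (m%:R : R) m0 IH => x x0 IH e.
have p0 : 0 < 9 * (x + 1) ^+ 2 by rewrite mulr_gt0 // exprn_gt0 //; lra.
rewrite -(ler_pM2l p0) e mulr1.
apply: (@le_trans _ _ ((3 * x + 1) * (3 * x + 2) * 1)); last by nra.
by rewrite ler_wpM2l // mulr_ge0; lra.
Qed.

Lemma hypS_le1 m : nc (fhypS R[i] m) <= 1.
Proof.
rewrite /= ncM ncV nc_nat; case: m => [|m]; first by rewrite invr0 mulr0.
rewrite ler_pdivrMr ?ltr0n // mul1r (le_trans (hyp_le1 _)) //.
by rewrite ler1n.
Qed.

(** Cutting S and every Y^m at the same order makes the double sums match; the errors (1/2)^m q^N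
    add up to at most 2 q^N. *)
Lemma evals_comp N :
  nc (\sum_(m < N) fhypS R[i] m * Yfun u ^+ m - feval (fE R[i]) N) <= 2 * q ^+ N.
Proof.
have -> : feval (fE R[i]) N
    = \sum_(m < N) fhypS R[i] m * feval (fY R[i] ^+ m) N.
  under [RHS]eq_bigr do rewrite mulr_sumr.
  rewrite exchange_big; apply: eq_bigr => n _.
  rewrite (@fcompE _ N) ?fY0 // mulr_suml.
  by apply: eq_bigr => m _; rewrite mulrA.
rewrite -sumrB (le_trans (nc_sum _ _ _)) //.
apply: (@le_trans _ _ (\sum_(m < N) (1 / 2) ^+ m * q ^+ N)).
  apply: ler_sum => m _; rewrite -mulrBr ncM -[leRHS]mul1r.
  apply: ler_pM; rewrite ?nc_ge0 ?hypS_le1 //.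
  by have [] := evals_YX m N.
rewrite -mulr_suml ler_wpM2r ?exprn_ge0 //.
have := subrX1 (1 / 2 : R) N; set S := \sum_(n < N) _ => e.
have : 0 <= (1 / 2 : R) ^+ N by rewrite exprn_ge0 //; lra.
by lra.
Qed.

End Evaluation.

(** * Summation over the cube roots of unity *)

Section CubeRoots.
Variable R : realType.
Local Notation nc := (@ComplexField.Normc.normc R).
Local Notation z := (zeta3 R).

(** From z^3 = 1 and z <> 1; [ring] uses this relation for the later identities in z. *)
Lemma zeta3_quad : z ^+ 2 = - 1 - z.
Proof.
have z3 : z ^+ 3 = 1.
  by rewrite /zeta3 -expiMn mul1r mulfV ?pnatr_eq0 // expi1.
have z1 : z != 1.
  apply/eqP => /(congr1 (fun w : R[i] => Im w)) /=; apply/eqP/lt0r_neq0.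
  by apply: sin_gt0_pi; have := pi_gt0 R; lra.
have : (z - 1) * (z ^+ 2 + z + 1) = 0.
  have -> : (z - 1) * (z ^+ 2 + z + 1) = z ^+ 3 - 1 by ring.
  by rewrite z3 subrr.
move/eqP; rewrite mulf_eq0 subr_eq0 (negbTE z1) /= => /eqP e.
by rewrite -[LHS]subr0 -e; ring.
Qed.

Lemma zeta3_cube : z ^+ 3 = 1.
Proof. by have e := zeta3_quad; ring: e. Qed.

Lemma nc_zeta3 : nc z = 1.
Proof. exact: nc_expi. Qed.

(** Induction by blocks of three exponents; those not divisible by 3 cancel through 1 + z + z^2 =
    0. *)
Lemma sum_cube_roots (e : nat -> R[i]) (u : R[i]) M :
  \sum_(j < 3) \sum_(n < 3 * M) e n * (z ^+ j * u) ^+ n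
  = \sum_(m < M) (3 * e (3 * m)%N) * (u ^+ 3) ^+ m.
Proof.
elim: M => [|M IH].
  by rewrite muln0 big_ord0 big1 // => j _; rewrite big_ord0.
rewrite [RHS]big_ord_recr /= -IH.
have -> : (3 * M.+1 = (3 * M).+3)%N by lia.
under eq_bigr do rewrite !big_ord_recr /= -!addrA.
rewrite big_split /=; congr (_ + _).
rewrite !big_ord_recr big_ord0 /= add0r expr0 expr1 mul1r.
have E k : (z ^+ k * u) ^+ (3 * M) = (u ^+ 3) ^+ M.
  rewrite exprM; congr (_ ^+ _).
  by rewrite exprMn -exprM mulnC exprM zeta3_cube expr1n mul1r.
have E1 := E 1%N; rewrite expr1 in E1.
rewrite ![_ ^+ (3 * M).+2]exprS ![_ ^+ (3 * M).+1]exprS E E1 exprM.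
by have e2 := zeta3_quad; ring: e2.
Qed.

(** As 1 + u + u^2 is (1 - u^3) / (1 - u) and the three 1 - z^j u multiply to 1 - u^3, one of three
    powers of 1 - u^3 cancels. *)
Lemma prod_cube_roots_quad (u : R[i]) :
  (1 + u + u ^+ 2) * (1 + z * u + (z * u) ^+ 2) *
  (1 + z ^+ 2 * u + (z ^+ 2 * u) ^+ 2) = (1 - u ^+ 3) ^+ 2.
Proof. by have e := zeta3_quad; ring: e. Qed.

Lemma prod_cube_roots_lin (u : R[i]) :
  (1 + 2 * u) * (1 + 2 * (z * u)) * (1 + 2 * (z ^+ 2 * u)) = 1 - (-8 * u ^+ 3).
Proof. by have e := zeta3_quad; ring: e. Qed.

End CubeRoots.

(** * Cancellation of logarithms and passage to the limit *)

Section Assembly.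
Variable R : realType.
Local Notation nc := (@ComplexField.Normc.normc R).
Local Notation z := (zeta3 R).
Local Notation s_ := (fhypS R[i]).

Lemma half_bounded_eq0 (D C : R) : (forall M, `|D| <= C * (1 / 2) ^+ M) -> D = 0.
Proof.
move=> h; apply/eqP; rewrite -normr_le0 leNgt; apply/negP => D0.
have C0 : 0 <= C by have := h 0%N; rewrite expr0; lra.
pose n := Num.bound (C / `|D|).
have hn : C / `|D| < n%:R.
  by apply: le_lt_trans (archi_boundP _); rewrite ?divr_ge0 //; exact: ler_norm.
have := h n; rewrite expr_div_n expr1n.
have p2 : (n%:R : R) <= 2 ^+ n by rewrite -natrX ler_nat ltnW // ltn_expl.
have q2 : 0 < (2 : R) ^+ n by rewrite exprn_gt0.
rewrite mulrA mulr1 ler_pdivlMr //; apply/negP; rewrite -ltNge.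
move: hn; rewrite ltr_pdivrMr // => /lt_le_trans; apply.
by rewrite mulrC ler_wpM2l.
Qed.

Lemma ln_Yfun (u : R[i]) : 0 < nc u -> nc u <= 1 / 8 ->
  [/\ 0 < nc (1 + u + u ^+ 2), 0 < nc (1 + 2 * u), 0 < nc (Yfun u) &
   ln (nc (Yfun u)) = 2 * ln 3 + ln (nc u) + ln (nc (1 + u + u ^+ 2))
    - 3 * ln (nc (1 + 2 * u))].
Proof.
move=> u0 u8.
have h1 : 0 < nc (1 + u + u ^+ 2).
  have -> : 1 + u + u ^+ 2 = 1 - (- u - u ^+ 2) by ring.
  have := nc_subl 1 (- u - u ^+ 2); have := ncB (- u) (u ^+ 2).
  rewrite nc1 ncN ncX.
  have : nc u ^+ 2 <= 1 / 8 * nc u by rewrite expr2 ler_wpM2r // nc_ge0.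
  by lra.
have h2 : 0 < nc (1 + 2 * u).
  have := nc_subl 1 (- (2 * u)); rewrite opprK ncN ncM nc1 nc_nat.
  by lra.
have nz : 1 + 2 * u != 0 by rewrite -nc_gt0.
have -> : Yfun u = 3 ^+ 2 * u * (1 + u + u ^+ 2) / (1 + 2 * u) ^+ 3.
  by rewrite /Yfun; field.
have i3 : 0 < nc (3 ^+ 2 : R[i]) by rewrite ncX nc_nat exprn_gt0.
split => //.
  rewrite ncM ncV [nc ((1 + 2 * u) ^+ 3)]ncX divr_gt0 ?exprn_gt0 //.
  by rewrite ncM [nc (_ * u)]ncM !mulr_gt0.
rewrite ncM [nc (_ * (1 + u + u ^+ 2))]ncM [nc (_ * u)]ncM ncV.
rewrite ![nc (_ ^+ _)]ncX nc_nat.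
rewrite ln_div ?lnM ?posrE ?mulr_gt0 ?exprn_gt0 //.
by ring.
Qed.

(** By [fE_coef3], S(u^3) is joined by truncations of -2 log (1 - u^3) and 3 log (1 + 8 u^3), which
    cancel against the sum of log |Y(z^j u)|. *)
Lemma sum_fE (u : R[i]) M :
  \sum_(j < 3) feval (z ^+ j * u) (fE R[i]) (3 * M.+1)
  = \sum_(m < M.+1) s_ m * (u ^+ 3) ^+ m
   + 2 * (\sum_(m < M) (u ^+ 3) ^+ m.+1 / m.+1%:R)
   - 3 * (\sum_(m < M) (- 8 * u ^+ 3) ^+ m.+1 / m.+1%:R).
Proof.
have E0 : fE R[i] 0%N = 0 by rewrite /= big_ord1 /= invr0 mulr0 mul0r.
rewrite [LHS]sum_cube_roots !big_ord_recl muln0 E0.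
have -> : s_ ord0 = 0 by rewrite /= invr0 mulr0.
rewrite mulr0 !mul0r !add0r !mulr_sumr -big_split -sumrB.
move: (fE R[i]) (fE_coef3 R[i]) => F F3.
apply: eq_bigr => m _ /=; rewrite /bump /= add1n [(-8 * u ^+ 3) ^+ _]exprMn.
have := F3 m.+1; rewrite -[_ *+ (3 * m.+1)]mulr_natr natrM.
have : m.+1%:R != 0 :> R[i] by rewrite pnatr_eq0.
move: (m.+1%:R : R[i]) (F (3 * m.+1)%N) (hyp _ _) ((-8) ^+ m.+1)
  ((u ^+ 3) ^+ m.+1) => k f h a b k0 E.
have -> : 3 * f = (h + 2 - 3 * a) / k by rewrite -E; field.
by field.
Qed.

(** Here p and p8 are log |1 - u^3| and log |1 + 8 u^3|. The errors of 3n, the 3y, the a - e, 2p and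
    3 p8 weigh 3 + 9 + 6 + 2 + 3 = 23, divided by 3 at the end. *)
Lemma telescope_bound (n y0 y1 y2 l3 lu l0 l1 l2 a a0 a1 a2 e0 e1 e2 s1 s8 p p8 h : R) :
  `|3 * n - (3 * l3 - 3 * lu - a)| <= 3 * h ->
  `|3 * y0 - (3 * l3 - l0 - a0)| <= 3 * h ->
  `|3 * y1 - (3 * l3 - l1 - a1)| <= 3 * h ->
  `|3 * y2 - (3 * l3 - l2 - a2)| <= 3 * h ->
  `|a0 - e0| <= 2 * h -> `|a1 - e1| <= 2 * h -> `|a2 - e2| <= 2 * h ->
  `|p + s1| <= h -> `|p8 + s8| <= h ->
  l0 + l1 + l2 = 6 * l3 + 3 * lu + 2 * p - 3 * p8 ->
  e0 + e1 + e2 = a + 2 * s1 - 3 * s8 ->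
  `|n - (y0 + y1 + y2)| <= 23 / 3 * h.
Proof.
rewrite !ler_norml => /andP[? ?] /andP[? ?] /andP[? ?] /andP[? ?].
move=> /andP[? ?] /andP[? ?] /andP[? ?] /andP[? ?] /andP[? ?] E1 E2.
apply/andP; split; lra.
Qed.

Lemma ltn_3mulS (M : nat) : (M < 3 * M.+1)%N.
Proof. by lia. Qed.

Theorem nfun_cubic (u : R[i]) : 0 < nc u < 1 / 40 / 1000 ->
  nfun (u ^+ 3) = \sum_(j < 3) nfun (Yfun (z ^+ j * u)).
Proof.
move=> /andP[u0 u1].
(* This radius keeps 2304 r below 1/8, hence |Y| too, and |u| < r / 2 allows the rate q = 1/2. *)
pose r : R := 1 / 20 / 1000.
pose v j := z ^+ j * u.
have nv j : nc (v j) = nc u by rewrite ncM ncX nc_zeta3 expr1n mul1r.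
have r0 : 0 < r by rewrite /r; lra.
have q0 : 0 <= 1 / 2 :> R by lra.
have q1 : 1 / 2 <= 1 :> R by lra.
have vr j : nc (v j) <= r * (1 / 2) by rewrite nv /r; lra.
have r4 : r <= 1 / 4 by rewrite /r; lra.
have rY : 2304 * r <= 1 / 8 by rewrite /r; lra.
have v8 j : nc (v j) <= 1 / 8 by rewrite nv; lra.
have v0 j : 0 < nc (v j) by rewrite nv.
have y8 j : 0 < nc (Yfun (v j)) <= 1 / 8.
  have [_ _ -> _] := ln_Yfun (v0 j) (v8 j).
  exact: le_trans (evals_bound (evals_Y r0 q0 q1 (vr j) r4)) rY.
have u3 : nc (u ^+ 3) = nc u ^+ 3 by rewrite ncX.
have u3small : nc u ^+ 3 <= 1 / 16.
  have : nc u ^+ 3 <= (1 / 4) ^+ 3 by rewrite lerXn2r ?nnegrE ?nc_ge0 //; lra.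
  by have -> : (1 / 4) ^+ 3 = 1 / 64 :> R by [field]; lra.
have u3pos : 0 < nc u ^+ 3 by rewrite exprn_gt0.
have t8 : 0 < nc (u ^+ 3) <= 1 / 8 by rewrite u3 u3pos /=; lra.
have lnsum : \sum_(j < 3) ln (nc (Yfun (v j))) = 6 * ln 3 + 3 * ln (nc u)
    + 2 * ln (nc (1 - u ^+ 3)) - 3 * ln (nc (1 - (-8 * u ^+ 3))).
  have [a0 b0 _ e0] := ln_Yfun (v0 0%N) (v8 0%N).
  have [a1 b1 _ e1] := ln_Yfun (v0 1%N) (v8 1%N).
  have [a2 b2 _ e2] := ln_Yfun (v0 2%N) (v8 2%N).
  rewrite !big_ord_recr big_ord0 /= add0r e0 e1 e2 !nv.
  have w0 : v 0%N = u by rewrite /v expr0 mul1r.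
  have w1 : v 1%N = z * u by rewrite /v expr1.
  rewrite w0 in a0 b0 *; rewrite w1 in a1 b1 *; rewrite /v in a2 b2 *.
  have -> : ln (nc (1 - (-8 * u ^+ 3))) = ln (nc (1 + 2 * u))
      + ln (nc (1 + 2 * (z * u))) + ln (nc (1 + 2 * (z ^+ 2 * u))).
    rewrite -prod_cube_roots_lin ncM [nc ((1 + 2 * u) * _)]ncM.
    by rewrite !lnM ?posrE ?mulr_gt0.
  have -> : 2 * ln (nc (1 - u ^+ 3)) = ln (nc (1 + u + u ^+ 2))
      + ln (nc (1 + z * u + (z * u) ^+ 2))
      + ln (nc (1 + z ^+ 2 * u + (z ^+ 2 * u) ^+ 2)).
    transitivity (ln (nc ((1 - u ^+ 3) ^+ 2))).
      rewrite ncX lnXn; first by ring.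
      have := nc_subl 1 (u ^+ 3); rewrite nc1 u3; lra.
    rewrite -prod_cube_roots_quad ncM [nc ((1 + u + u ^+ 2) * _)]ncM.
    by rewrite !lnM ?posrE ?mulr_gt0.
  by ring.
apply/eqP; rewrite -subr_eq0; apply/eqP.
apply: (@half_bounded_eq0 _ (23 / 3)) => M.
pose h : R := (1 / 2) ^+ M.
have h0 : 0 <= h by rewrite exprn_ge0 //; lra.
have hle N : (M <= N)%N -> (1 / 2) ^+ N <= h.
  by move=> MN; apply: ler_wiXn2l; [lra | lra | exact: MN].
pose A (t : R[i]) N := Re (\sum_(m < N) s_ m * t ^+ m).
(* Every truncation order used for n exceeds M, so one tolerance h serves all of them. *)
have nfunA t N : 0 < nc t <= 1 / 8 -> (M < N)%N ->
    `|3 * nfun t - (3 * ln 3 - ln (nc t) - A t N)| <= 3 * h.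
  case: N => // N t8' MN; apply: le_trans (nfun_expand N t8') _.
  by rewrite ler_pM2l ?ltr0n //; apply: hle; rewrite ltnS in MN.
have evA j : `|A (Yfun (v j)) (3 * M.+1)
    - Re (feval (v j) (fE R[i]) (3 * M.+1))| <= 2 * h.
  rewrite /A -ReB (le_trans (normRe_le _)) //.
  apply: le_trans (evals_comp r0 q0 q1 (vr j) r4 rY _) _.
  by rewrite ler_pM2l ?ltr0n //; exact: hle (ltnW (ltn_3mulS M)).
have lnu : `|ln (nc (1 - u ^+ 3))
    + Re (\sum_(m < M) (u ^+ 3) ^+ m.+1 / m.+1%:R)| <= h.
  apply: le_trans (ln_taylor M _) _; first by rewrite u3; lra.
  rewrite exprS mulrA; apply: (@le_trans _ _ (1 * nc (u ^+ 3) ^+ M)).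
    by rewrite ler_wpM2r ?exprn_ge0 ?nc_ge0 // u3; lra.
  by rewrite mul1r /h lerXn2r ?nnegrE ?nc_ge0 // u3; lra.
have n8 : nc (-8 * u ^+ 3) = 8 * nc u ^+ 3 by rewrite ncM ncN nc_nat u3.
have ln8u : `|ln (nc (1 - (-8 * u ^+ 3)))
    + Re (\sum_(m < M) (-8 * u ^+ 3) ^+ m.+1 / m.+1%:R)| <= h.
  apply: le_trans (ln_taylor M _) _; first by rewrite n8; lra.
  rewrite exprS mulrA; apply: (@le_trans _ _ (1 * nc (-8 * u ^+ 3) ^+ M)).
    by rewrite ler_wpM2r ?exprn_ge0 ?nc_ge0 // n8; lra.
  by rewrite mul1r /h lerXn2r ?nnegrE ?nc_ge0 // n8; lra.
have sumE := congr1 (fun w : R[i] => Re w) (sum_fE u M).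
move: sumE; rewrite /= ReB ReD Re_sum.
have Re2 (w : R[i]) : Re (2 * w) = 2 * Re w by rewrite !mulr_natl Re_mulrn.
have Re3 (w : R[i]) : Re (3 * w) = 3 * Re w by rewrite !mulr_natl Re_mulrn.
rewrite Re2 Re3 -/(A (u ^+ 3) M.+1).
move: lnu ln8u; set L1 := Re (\sum_(m < M) (u ^+ 3) ^+ _ / _).
set L8 := Re (\sum_(m < M) (-8 * u ^+ 3) ^+ _ / _) => lnu ln8u sumE.
have nu := nfunA _ _ t8 (ltnSn M).
rewrite u3 lnXn // in nu.
(* Order 3 (M + 1) in Y matches order M + 1 in u^3, as [sum_fE] pairs exponent 3m of u with exponent
   m of u^3. *)
have n0 := nfunA _ (3 * M.+1)%N (y8 0%N) (ltn_3mulS M).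
have n1 := nfunA _ (3 * M.+1)%N (y8 1%N) (ltn_3mulS M).
have n2 := nfunA _ (3 * M.+1)%N (y8 2%N) (ltn_3mulS M).
have ev0 := evA 0%N; have ev1 := evA 1%N; have ev2 := evA 2%N.
move: lnsum sumE; rewrite -/h !big_ord_recr !big_ord0 /= !add0r.
rewrite -/(v 0%N) -/(v 1%N) -/(v 2%N) => lnsum sumE.
rewrite -[ln (nc u) *+ 3]mulr_natl in nu.
exact: telescope_bound nu n0 n1 n2 ev0 ev1 ev2 lnu ln8u lnsum sumE.
Qed.

End Assembly.

Theorem mainTheorem7 (R : realType) :
  exists delta : R, 0 < delta /\
    forall u : R[i], 0 < ComplexField.Normc.normc u < delta ->
      nfun (u ^+ 3) = \sum_(j < 3) nfun (Yfun (zeta3 R ^+ j * u)).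
Proof.
exists (1 / 40 / 1000); split; first by lra.
exact: nfun_cubic.
Qed.
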